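(* Let $|v\rangle,|w\rangle\in\mathcal F$ and suppose $f=\langle0|e^{\mathcal H^{(\beta)}(x)}|v\rangle$ and $g=\langle0|e^{\mathcal H^{[\beta]}(x)}|w\rangle$. Then $$\langle f,g\rangle=\langle w|v\rangle,$$ where on the left $\langle\cdot,\cdot\rangle$ is the $\beta$-deformed bilinear form, and on the right $\langle w|=|w\rangle^\ast$ and the pairing is the vacuum expectation value pairing $\mathcal E\otimes_k\mathcal F\to k$.
   Context: **Fermions.** $k=\mathbb Q(\beta)$. $\mathcal A$ is the unital associative $k$-algebra generated by $\phi_n$ ($n\in\mathbb Z$) with relations $\phi_m\phi_n+\phi_n\phi_m=2(-1)^m\delta_{m+n,0}$. The Fock space $\mathcal F=\mathcal A|0\rangle$ is the left module with $\phi_{-n}|0\rangle=0$ ($n>0$) and $k$-basis $\phi_{n_1}\cdots\phi_{n_r}|0\rangle$ ($r\ge0$, $n_1>\dots>n_r\ge0$, $r$ of either parity); $\mathcal E=\langle0|\mathcal A$ is the right module with $\langle0|\phi_n=0$ ($n>0$) and $k$-basis $\langle0|\phi_{m_1}\cdots\phi_{m_r}$ ($r\ge0$, $0\ge m_1>\dots>m_r$). The vacuum expectation value pairing $\mathcal E\otimes_k\mathcal F\to k$ is determined by $\langle0|0\rangle=1$, $(\langle w|X)|v\rangle=\langle w|(X|v\rangle)$ for $X\in\mathcal A$, and $\langle0|\phi_0|0\rangle=0$. The anti-automorphism $X\mapsto X^\ast$ of $\mathcal A$ has $\phi_n^\ast=(-1)^n\phi_{-n}$, $(XY)^\ast=Y^\ast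 X^\ast$, and induces mutually inverse maps $\mathcal E\leftrightarrow\mathcal F$, $\langle0|X\leftrightarrow X^\ast|0\rangle$, also denoted $\ast$. **Operators.** For odd $m$, $b_m=\frac14\sum_{i\in\mathbb Z}(-1)^i\phi_{-i-m}\phi_i$; one has $b_m^\ast=b_{-m}$. For $m\in\mathbb Z$, $b^{(\beta)}_m$ is obtained from $\frac{(X-\frac\beta2)^m-(-X-\frac\beta2)^m}2$, expanded as a polynomial in $X$ if $m\ge0$ and as a power series in $X^{-1}$ if $m<0$, by $X^l\mapsto b_l$ (only odd $l$ occur). Put $b^{[\beta]}_n=(b^{(\beta)}_{-n})^\ast$. With $p_n=p_n(x)=\sum_ix_i^n$, let $$\mathcal H^{(\beta)}(x)=2\sum_{n\ge1}\frac{p_n(x)}nb^{(\beta)}_n,\qquad \mathcal H^{[\beta]}(x)=2\sum_{n\ge1}\frac{p_n(x)}nb_n^{[\beta]},$$ so $\mathcal H^{[\beta]}=(\mathcal H_-^{(\beta)})^\ast$ with $\mathcal H^{(\beta)}_-=2\sum_{n\ge1}\frac{p_n(x)}nb^{(\beta)}_{-n}$. The exponentials act on $\mathcal F$, and $\langle0|e^{\mathcal H}|v\rangle$ means $\langle0|$ paired coefficientwise with $e^{\mathcal H}|v\rangle$. **Bilinear form.** Put $p_n^{(\beta)}(x)=\sum_i\left(\frac{x_i}{1+\frac\beta2x_i}\right)^n$ (a symmetric formal power series) and $p_n^{[\beta]}(x)=\sum_i\left\{(x_i+\tfrac\beta2)^n-(\tfrac\beta2)^n\right\}$; for a partition $\lambda$,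 $p^{(\beta)}_\lambda=\prod_ip^{(\beta)}_{\lambda_i}$, $p^{[\beta]}_\lambda=\prod_ip^{[\beta]}_{\lambda_i}$. A partition is odd if all its parts are odd. Let $\mathcal U$ be the $k$-span of the $p^{(\beta)}_\lambda$ ($\lambda$ odd) and $g\Gamma$ the $k$-span of the $p^{[\beta]}_\lambda$ ($\lambda$ odd) (these families are linearly independent). The $\beta$-deformed bilinear form is defined on $\mathcal U\otimes_kg\Gamma$ by $\langle p_\lambda^{(\beta)},p_\mu^{[\beta]}\rangle=2^{-\ell(\lambda)}z_\lambda\delta_{\lambda,\mu}$ for $\lambda,\mu$ odd, where $\ell(\lambda)$ is the number of parts of $\lambda$, $z_\lambda=\prod_{i\ge1}i^{m_i}m_i!$ and $m_i$ is the number of parts of $\lambda$ equal to $i$ (the paper then extends it by continuity in the first argument; here $f\in\mathcal U$ and $g\in g\Gamma$, so the values on $\mathcal U\otimes_k g\Gamma$ suffice).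
   Formalization: It is assumed in addition that |v⟩ or |w⟩ lies in the even part of F (span of words with r even); without this the claim fails, e.g. for |v⟩=|w⟩=φ_0|0⟩, where f=g=0 but ⟨w|v⟩=1. *)

(* Defs.v *)
From HB Require Import structures.
From mathcomp Require Import all_boot all_order all_algebra.
From mathcomp Require Import finmap.
From mathcomp Require Import boolp classical_sets functions cardinality fsbigop.

Set Implicit Arguments.
Unset Strict Implicit.
Unset Printing Implicit Defensive.

Import Order.TTheory GRing.Theory Num.Theory.
Local Open Scope classical_set_scope.
Local Open Scope ring_scope.

(* Throughout, [\sum_(i \in D) F i] is the finitely supported sum of fsbigop.
   It renders every infinite sum below; each of them has only finitely many
   nonzero terms once it is evaluated on a vector, or at a given monomial. *)

Notation Qbeta := {fraction {poly rat}}.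
Definition beta : Qbeta := tofrac ('X : {poly rat}).

(** * Linear algebra *)

Definition in_span (I : eqType) (V : lmodType Qbeta) (P : pred I) (e : I -> V)
    (v : V) : Prop :=
  exists2 s : seq I, all P s &
    exists c : I -> Qbeta, v = \sum_(i <- s) c i *: e i.

Definition lin_indep (I : eqType) (V : lmodType Qbeta) (P : pred I)
    (e : I -> V) : Prop :=
  forall (s : seq I) (c : I -> Qbeta), uniq s -> all P s ->
    \sum_(i <- s) c i *: e i = 0 -> {in s, forall i, c i = 0}.

Definition is_basis (I : eqType) (V : lmodType Qbeta) (P : pred I)
    (e : I -> V) : Prop :=
  (forall v, in_span P e v) /\ lin_indep P e.

Definition is_left_module (A : algType Qbeta) (V : lmodType Qbeta)
    (act : A -> V -> V) : Prop :=
  [/\ forall X, linear (act X), forall v, linear (act^~ v),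
      forall v, act 1 v = v & forall X Y v, act (X * Y) v = act X (act Y v)].

Definition is_right_module (A : algType Qbeta) (V : lmodType Qbeta)
    (act : V -> A -> V) : Prop :=
  [/\ forall X, linear (act^~ X), forall u, linear (act u),
      forall u, act u 1 = u & forall X Y u, act u (X * Y) = act (act u X) Y].

(** * Neutral fermions *)

Definition fermion_relations (A : algType Qbeta) (phi : int -> A) : Prop :=
  forall m n : int,
    phi m * phi n + phi n * phi m = (2 * (-1) ^ m * (m + n == 0)%:R)%:A.

(* [A] is the algebra presented by the generators [phi] and these relations. *)
Definition fermion_presentation (A : algType Qbeta) (phi : int -> A) : Prop :=
  fermion_relations phi /\
  forall (B : algType Qbeta) (psi : int -> B), fermion_relations psi ->
    exists2 h : {lrmorphism A -> B}, (forall n, h (phi n) = psi n) &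
      forall h' : {lrmorphism A -> B}, (forall n, h' (phi n) = psi n) ->
        h' =1 h.

Definition fock_word (s : seq int) : bool :=
  sorted (fun a b : int => b < a) s && all (fun a : int => 0 <= a) s.

Definition dual_word (s : seq int) : bool :=
  sorted (fun a b : int => b < a) s && all (fun a : int => a <= 0) s.

Record neutral_fermions := NeutralFermions {
  alg : algType Qbeta;
  phi : int -> alg;
  algP : fermion_presentation phi;

  fock : lmodType Qbeta;
  lact : alg -> fock -> fock;
  vac : fock;
  lactP : is_left_module lact;
  vac_annihilated : forall n : int, 0 < n -> lact (phi (- n)) vac = 0;
  fock_basis : is_basis fock_word (fun s => lact (\prod_(n <- s) phi n) vac);

  dual_fock : lmodType Qbeta;
  ract : dual_fock -> alg -> dual_fock;
  covac : dual_fock;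
  ractP : is_right_module ract;
  covac_annihilated : forall n : int, 0 < n -> ract covac (phi n) = 0;
  dual_basis : is_basis dual_word (fun s => ract covac (\prod_(n <- s) phi n));

  pairing : dual_fock -> fock -> Qbeta;
  pairing_linear_l : forall v, linear (pairing^~ v : dual_fock -> Qbeta^o);
  pairing_linear_r : forall u, linear (pairing u : fock -> Qbeta^o);
  pairing_act : forall u X v, pairing (ract u X) v = pairing u (lact X v);
  pairing_vac : pairing covac vac = 1;
  pairing_phi0 : pairing covac (lact (phi 0) vac) = 0;

  star : alg -> alg;
  star_linear : linear star;
  star_bij : bijective star;
  star1 : star 1 = 1;
  starM : forall X Y, star (X * Y) = star Y * star X;
  star_phi : forall n : int, star (phi n) = (-1) ^ n *: phi (- n);

  star_fock : fock -> dual_fock;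
  star_dual : dual_fock -> fock;
  star_fockE : forall X, star_fock (lact X vac) = ract covac (star X);
  star_dualE : forall X, star_dual (ract covac X) = lact (star X) vac;
  star_fockK : cancel star_fock star_dual;
  star_dualK : cancel star_dual star_fock
}.

(* Both [boson] maps below kill the span of the odd words, while the pairing is
   nondegenerate on it: v = w = phi_0 |0> has f = g = 0 and <w|v> = 1. *)
Definition fock_even (M : neutral_fermions) (v : fock M) : Prop :=
  in_span (fun s : seq int => fock_word s && ~~ odd (size s))
    (fun s => lact (\prod_(n <- s) phi M n) (vac M)) v.

(** * The operators b *)

Definition odd_int : set int := [set l : int | odd `|l|%N].

(* Newton's expansion (X + c)^m = sum_(j >= 0) binom(m, j) c^j X^(m - j): a
   polynomial in X if m >= 0, a power series in X^-1 if m < 0. *)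
Definition gen_binom (m : int) (j : nat) : Qbeta :=
  (\prod_(i < j) (m%:~R - i%:R)) / j`!%:R.

Definition shift_coef (c : Qbeta) (m l : int) : Qbeta :=
  if l <= m then gen_binom m `|m - l|%N * c ^+ `|m - l|%N else 0.

(* Coefficient of X^l in ((X - beta/2)^m - (- X - beta/2)^m) / 2, where
   (- X - beta/2)^m = (-1)^m (X + beta/2)^m. *)
Definition bcoef (m l : int) : Qbeta :=
  (shift_coef (- (beta / 2)) m l - (-1) ^ m * shift_coef (beta / 2) m l) / 2.

Section Operators.
Variable M : neutral_fermions.

Definition b_fock (m : int) (v : fock M) : fock M :=
  4^-1 *: \sum_(i \in [set: int])
            (-1) ^ i *: lact (phi M (- i - m) * phi M i) v.

Definition b_dual (u : dual_fock M) (m : int) : dual_fock M :=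
  4^-1 *: \sum_(i \in [set: int])
            (-1) ^ i *: ract u (phi M (- i - m) * phi M i).

Definition b_beta (m : int) (v : fock M) : fock M :=
  \sum_(l \in odd_int) bcoef m l *: b_fock l v.

(* For m < 0 the series b^(beta)_m acts on the right on the dual Fock space;
   its adjoint under star then acts on the Fock space. *)
Definition b_beta_dual (u : dual_fock M) (m : int) : dual_fock M :=
  \sum_(l \in odd_int) bcoef m l *: b_dual u l.

Definition b_bra (n : int) (v : fock M) : fock M :=
  star_dual (b_beta_dual (star_fock v) (- n)).

End Operators.

(** * Formal power series in x_0, x_1, ... *)

(* A monomial is its finitely supported exponent function, and a series its
   coefficient function. *)
Notation monomial := {fsfun nat -> nat with 0%N}.
Definition mon1 : monomial := [fsfun].
Definition xpow (i n : nat) : monomial := [fsfun mon1 with i |-> n].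

Definition series (V : Type) := monomial -> V.

Definition conv (U V : Type) (Z : lmodType Qbeta) (op : U -> V -> Z)
    (f : series U) (g : series V) : series Z :=
  fun m => \sum_(ab \in [set ab : monomial * monomial |
                           forall i, (ab.1 i + ab.2 i)%N = m i])
              op (f ab.1) (g ab.2).

Definition scst (V : lmodType Qbeta) (v : V) : series V :=
  fun m => if m == mon1 then v else 0.

(* [Qbeta^o] is Qbeta as a vector space over itself.  The product of series is
   [smul]; [pseries] carries no ring structure. *)
Notation pseries := (series Qbeta^o).

Definition smul (f g : pseries) : pseries := conv (Z := Qbeta^o) *%R f g.
Definition sone : pseries := scst (1 : Qbeta^o).
Definition sexp (f : pseries) (n : nat) : pseries := iter n (smul f) sone.
Definition sprod (fs : seq pseries) : pseries := foldr smul sone fs.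

Definition svar (i n : nat) : pseries := fun m => (m == xpow i n)%:R.
Definition ssum (F : nat -> pseries) : pseries :=
  fun m => \sum_(i \in [set: nat]) F i m.

Definition psum (n : nat) : pseries := ssum (fun i => svar i n).

(* x_i / (1 + (beta/2) x_i) *)
Definition xdeform (i : nat) : pseries :=
  ssum (fun j => (- (beta / 2)) ^+ j *: svar i j.+1).

Definition psum_beta (n : nat) : pseries := ssum (fun i => sexp (xdeform i) n).

Definition psum_bra (n : nat) : pseries :=
  ssum (fun i => sexp (svar i 1 + (beta / 2) *: sone) n - (beta / 2) ^+ n *: sone).

(** * The series attached to vectors *)

Section Bosonization.
Variable M : neutral_fermions.

(* 2 sum_(n >= 1) p_n(x)/n B_n, as a power series whose coefficients are
   operators on the Fock space. *)
Definition hamiltonian (B : nat -> fock M -> fock M) :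
    series (fock M -> fock M) :=
  fun m v => \sum_(n \in [set n : nat | (0 < n)%N])
               (2 * psum n m / n%:R) *: B n v.

Definition H_beta := hamiltonian (fun n => b_beta (n : int)).
Definition H_bra := hamiltonian (fun n => b_bra (n : int)).

Definition op_app (H : series (fock M -> fock M)) (u : series (fock M)) :
    series (fock M) :=
  conv (fun T w => T w) H u.

Definition exp_app (H : series (fock M -> fock M)) (v : fock M) :
    series (fock M) :=
  fun m => \sum_(j \in [set: nat]) (j`!%:R)^-1 *: iter j (op_app H) (scst v) m.

Definition boson (H : series (fock M -> fock M)) (v : fock M) : pseries :=
  fun m => pairing (covac M) (exp_app H v m).

End Bosonization.

(** * The deformed bilinear form *)

Definition odd_part (la : seq nat) : bool :=
  sorted geq la && all odd la.

Definition p_beta (la : seq nat) : pseries := sprod (map psum_beta la).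
Definition p_bra (la : seq nat) : pseries := sprod (map psum_bra la).

Definition zee (la : seq nat) : nat :=
  (\prod_(i <- undup la) (i ^ count_mem i la * (count_mem i la)`!))%N.

Definition in_U (f : pseries) : Prop := in_span odd_part p_beta f.
Definition in_gGamma (g : pseries) : Prop := in_span odd_part p_bra g.

(* [form] restricts to the deformed bilinear form on U x gGamma; its values
   elsewhere are irrelevant. *)
Definition is_beta_form (form : pseries -> pseries -> Qbeta) : Prop :=
  [/\ forall a f1 f2 g, in_U f1 -> in_U f2 -> in_gGamma g ->
        form (a *: f1 + f2) g = a * form f1 g + form f2 g,
      forall a f g1 g2, in_U f -> in_gGamma g1 -> in_gGamma g2 ->
        form f (a *: g1 + g2) = a * form f g1 + form f g2 &
      forall la mu, odd_part la -> odd_part mu ->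
        form (p_beta la) (p_bra mu) =
          2 ^- size la * (zee la)%:R * (la == mu)%:R].

(* Main.v *)
(* Both sides are bilinear in v and w.  Since [b_l, b_(-m)] = (l/2) delta_(l,m) on the
   Fock space for odd l, m > 0, conjugating the creation operator b_(-k) by
   e^(H^(beta)) adds the scalar series p^(beta)_k to it, and conjugating it by
   e^(H^[beta]) adds p^[beta]_k; as <0| b_(-k) = 0, the vector b_(-mu)|0> is sent to
   p^(beta)_mu by the first map and to p^[beta]_mu by the second.  The commutation
   relations also give <b_(-nu)|0>, b_(-mu)|0>> = 2^(-l(mu)) z_mu delta_(mu,nu), which is
   the value of the form.  It remains to see that the b_(-mu)|0>, mu odd, span the even
   part of the Fock space.  In degree d they are orthogonal with nonzero norms, and
   Glaisher's map injects the strict partitions of d, which index the fermionic basis,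
   into the odd ones: so they span.  The odd part is killed by both maps and is
   orthogonal to the even part. *)

Require Import Defs.
From mathcomp Require Import all_boot all_order all_algebra.
From mathcomp Require Import finmap.
From mathcomp Require Import boolp classical_sets functions cardinality fsbigop.
From mathcomp Require Import zify ring.

Set Implicit Arguments.
Unset Strict Implicit.
Unset Printing Implicit Defensive.

Import Order.TTheory GRing.Theory Num.Theory.
Local Open Scope classical_set_scope.
Local Open Scope ring_scope.

(** The deformed power sums come out of Lagrange inversion. For odd k the two halves of the
    expression defining b^(beta)_n have the same coefficient at X^k, so commuting the p_n-summand of
    H^(beta) with b_(-k) leaves k/n times the coefficient of X^k in (X - beta/2)^n, which is the
    coefficient of t^n in (t/(1 + beta t/2))^k. With both exponents negated the result is the
    coefficient of t^n in (t + beta/2)^k; as n >= 1, the constant term is missing, hence the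
    subtraction of (beta/2)^k. The b_l are infinite sums, and b^[beta]_n is an infinite combination
    of them, so identities between operators are proved on one vector at a time, after a cut-off
    chosen for that vector. The mode phi_0 gives each strict partition two words of the same degree,
    with and without the letter 0. Fixing the parity of the length leaves exactly one of them, and
    this is what makes Glaisher's map injective on words. *)

Lemma fsum_seq (V : nmodType) (I : choiceType) (D : set I) (r : seq I)
    (F : I -> V) : uniq r -> (forall i, i \in D -> i \notin r -> F i = 0) ->
  \sum_(i \in D) F i = \sum_(i <- r | i \in D) F i.
Proof.
move=> ur F0; rewrite [RHS]bigfs//; apply: eq_fsbigl.
by apply/seteqP; split => i /=; rewrite ?inE// => Di; rewrite inE.
Qed.

(** * Linear maps and spans *)

Section LinearMaps.
Variables (U V : lmodType Qbeta) (f : U -> V).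
Hypothesis lf : linear f.

Lemma lin0 : f 0 = 0.
Proof. by have := lf (-1) 0 0; rewrite scaler0 addr0 scaleN1r addNr. Qed.

Lemma linD u v : f (u + v) = f u + f v.
Proof. by have := lf 1 u v; rewrite !scale1r. Qed.

Lemma linZ a u : f (a *: u) = a *: f u.
Proof. by have := lf a u 0; rewrite lin0 !addr0. Qed.

Lemma linN u : f (- u) = - f u.
Proof. by rewrite -!scaleN1r linZ. Qed.

Lemma lin_sum I (r : seq I) (P : pred I) (F : I -> U) :
  f (\sum_(i <- r | P i) F i) = \sum_(i <- r | P i) f (F i).
Proof. by apply: big_morph => //; [exact: linD|exact: lin0]. Qed.

(** Injectivity gives [F] and [f \o F] the same support; otherwise one sum could be finite while the
    other takes the default value 0 of an infinite support. *)
Lemma lin_fsum (I : choiceType) (D : set I) (F : I -> U) : injective f ->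
  f (\sum_(i \in D) F i) = \sum_(i \in D) f (F i).
Proof.
move=> injf; rewrite lin_sum; congr bigop.
suff : F @^-1` [set~ 0] = (f \o F) @^-1` [set~ 0].
  by rewrite /finite_support !unlock /= => ->.
by apply/seteqP; split => i /= Fi fi; apply: Fi; [apply: injf; rewrite lin0|rewrite fi lin0].
Qed.

End LinearMaps.

Lemma linear_sum (U V : lmodType Qbeta) I (r : seq I) (P : pred I)
    (F : I -> U -> V) : (forall i, linear (F i)) ->
  linear (fun u => \sum_(i <- r | P i) F i u).
Proof.
move=> lF a u v; rewrite scaler_sumr -big_split.
by apply: eq_bigr => i _; rewrite lF.
Qed.

Lemma linear_scale (U V : lmodType Qbeta) c (f : U -> V) :
  linear f -> linear (fun u => c *: f u).
Proof. by move=> lf a u v; rewrite lf scalerDr !scalerA mulrC. Qed.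

Lemma linear_comp (U V W : lmodType Qbeta) (f : U -> V) (g : V -> W) :
  linear f -> linear g -> linear (fun u => g (f u)).
Proof. by move=> lf lg a u v; rewrite lf lg. Qed.

Section Span.
Variables (I : eqType) (V : lmodType Qbeta) (P : pred I) (e : I -> V).

(** Lists in [in_span] may have repetitions; regrouping by multiplicity brings two combinations onto
    a common duplicate-free list. *)
Lemma sum_count (s t : seq I) (F : I -> V) : uniq t -> {subset s <= t} ->
  \sum_(i <- s) F i = \sum_(i <- t) F i *+ count_mem i s.
Proof.
move=> ut; elim: s => [|x s IH] st.
  by rewrite big_nil big1_seq// => i; rewrite mulr0n.
rewrite big_cons IH; last by move=> y ys; apply: st; rewrite inE ys orbT.
rewrite [RHS](eq_bigr (fun i => F i *+ (x == i) + F i *+ count_mem i s)).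
  rewrite big_split; congr (_ + _) => /=.
  rewrite (bigD1_seq x)//=; last by apply: st; rewrite inE eqxx.
  by rewrite eqxx big1 ?addr0// => i; rewrite eq_sym => /negbTE ->.
by move=> i _; rewrite -mulrnDr.
Qed.

Lemma in_span_lin a u v :
  in_span P e u -> in_span P e v -> in_span P e (a *: u + v).
Proof.
move=> [s1 Ps1 [c1 ->]] [s2 Ps2 [c2 ->]].
exists (undup (s1 ++ s2)); first by rewrite all_undup all_cat Ps1 Ps2.
exists (fun i => a * c1 i *+ count_mem i s1 + c2 i *+ count_mem i s2).
rewrite (@sum_count s1 (undup (s1 ++ s2))) ?undup_uniq//; last first.
  by move=> x xs; rewrite mem_undup mem_cat xs.
rewrite (@sum_count s2 (undup (s1 ++ s2))) ?undup_uniq//; last first.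
  by move=> x xs; rewrite mem_undup mem_cat xs orbT.
rewrite scaler_sumr -big_split; apply: eq_bigr => i _ /=.
by rewrite scalerDl -!scalerMnr -!scalerMnl scalerA.
Qed.

Lemma in_span0 : in_span P e 0.
Proof. by exists [::] => //; exists (fun=> 0); rewrite big_nil. Qed.

Lemma in_spanD u v : in_span P e u -> in_span P e v -> in_span P e (u + v).
Proof. by rewrite -[u in u + v]scale1r; apply: in_span_lin. Qed.

Lemma in_spanZ a u : in_span P e u -> in_span P e (a *: u).
Proof. by move=> eu; rewrite -[_ *: _]addr0; apply: in_span_lin => //; exact: in_span0. Qed.

Lemma in_span_sum J (r : seq J) (Q : pred J) (F : J -> V) :
  (forall j, Q j -> in_span P e (F j)) -> in_span P e (\sum_(j <- r | Q j) F j).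
Proof. by move=> eF; apply: (big_ind (in_span P e)) => //; [exact: in_span0|exact: in_spanD]. Qed.

Lemma in_span_gen i : P i -> in_span P e (e i).
Proof.
move=> Pi; exists [:: i]; first by rewrite /= Pi.
by exists (fun=> 1); rewrite big_seq1 scale1r.
Qed.

Lemma in_span_lift (T : V -> Prop) :
  T 0 -> (forall a u v, T u -> T v -> T (a *: u + v)) ->
  (forall i, P i -> T (e i)) -> forall v, in_span P e v -> T v.
Proof.
move=> T0 TD Te v [s Ps [c ->]]; elim: s Ps => [|i s IH] /=.
  by rewrite big_nil.
by case/andP => Pi Ps; rewrite big_cons; apply: TD; [exact: Te|exact: IH].
Qed.

End Span.

Lemma in_span_map (I J : eqType) (U V : lmodType Qbeta) (P : pred I)
    (e : I -> U) (Q : pred J) (g : J -> V) (f : U -> V) :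
  linear f -> (forall i, P i -> in_span Q g (f (e i))) ->
  forall u, in_span P e u -> in_span Q g (f u).
Proof.
move=> lf fe; apply: in_span_lift => //; first by rewrite lin0//; exact: in_span0.
by move=> a u v fu fv; rewrite lf; apply: in_span_lin.
Qed.

Lemma in_span_sub (I : eqType) (V : lmodType Qbeta) (P Q : pred I) (e : I -> V) v :
  (forall i, P i -> Q i) -> in_span P e v -> in_span Q e v.
Proof. by move=> PQ [s Ps cE]; exists s => //; apply: sub_all Ps. Qed.

(** * Neutral fermions and the operators b *)

Lemma sgnzD (i j : int) : (-1 : Qbeta) ^ (i + j) = (-1) ^ i * (-1) ^ j.
Proof. by rewrite expfzDr// oppr_eq0 oner_eq0. Qed.

Lemma sgnzN (i : int) : (-1 : Qbeta) ^ (- i) = (-1) ^ i.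
Proof. by rewrite -exprz_inv invrN1. Qed.

Lemma sgnz_sqr (i : int) : (-1 : Qbeta) ^ i * (-1) ^ i = 1.
Proof. by rewrite -{2}sgnzN -sgnzD subrr expr0z. Qed.

Lemma sgnz_odd (i : int) : odd `|i|%N -> (-1 : Qbeta) ^ i = -1.
Proof.
have sgn_nat (n : nat) : odd n -> (-1 : Qbeta) ^ n%:Z = -1.
  by move=> on; rewrite -exprnP -signr_odd on expr1.
by case: (intP i) => [//|n|n]; rewrite ?abszN ?absz_nat ?sgnzN; exact: sgn_nat.
Qed.

Lemma Qbeta_natr_neq0 n : (0 < n)%N -> (n%:R : Qbeta) != 0.
Proof.
move=> n0; rewrite -tofrac1 -tofracMn tofrac_eq0 -polyC1 -polyCMn polyC_eq0.
by rewrite pnatr_eq0 -lt0n.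
Qed.

Lemma quarter_double (K : fieldType) (x : K) : (2 : K) != 0 -> 4^-1 * (2 * x) = x / 2.
Proof. by move=> h2; rewrite (natrM _ 2 2) invfM -mulrA mulKf// mulrC. Qed.

(** * Symmetric windows of integers *)

Definition int_range (N : nat) : seq int :=
  [seq k%:Z - N%:Z | k <- iota 0 N.*2.+1].

Lemma int_range_uniq N : uniq (int_range N).
Proof. by rewrite map_inj_uniq ?iota_uniq// => i j; lia. Qed.

Lemma mem_int_range N (i : int) : (i \in int_range N) = (`|i| <= N)%N.
Proof.
apply/mapP/idP => [[k]|iN]; first by rewrite mem_iota; lia.
by exists (absz (i + N%:Z)); rewrite ?mem_iota; lia.
Qed.

Lemma int_range_sum (V : nmodType) (N : nat) (F : int -> V) (j : int) :
  (`|j| <= N)%N -> (forall i, i != j -> F i = 0) ->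
  \sum_(i <- int_range N) F i = F j.
Proof.
move=> jN F0; rewrite (bigD1_seq j) ?mem_int_range ?int_range_uniq//= big1 ?addr0//.
Qed.

Lemma int_rangeE (V : nmodType) N (F : int -> V) :
  \sum_(i <- int_range N) F i = \sum_(k < N.*2.+1) F (k%:Z - N%:Z).
Proof. by rewrite /int_range big_map -(big_mkord xpredT (fun k => F (k%:Z - N%:Z))). Qed.

Lemma int_range_opp (V : nmodType) N (F : int -> V) :
  \sum_(i <- int_range N) F i = \sum_(i <- int_range N) F (- i).
Proof.
rewrite -(big_map -%R xpredT); apply: perm_big; apply: uniq_perm.
- exact: int_range_uniq.
- by rewrite map_inj_uniq ?int_range_uniq//; exact: oppr_inj.
by move=> i; rewrite -[i in RHS]opprK (mem_map oppr_inj) !mem_int_range abszN.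
Qed.

(** Telescoping: the lower boundary vanishes by hypothesis, so a shift by [l] loses only the [l]
    topmost values. Their number is the source of the factor l in the commutator of b_l and
    b_(-l). *)
Lemma int_range_shift (V : nmodType) (N l : nat) (F : int -> V) :
  (forall i, i < - N%:Z -> F i = 0) ->
  \sum_(i <- int_range N) F i =
  \sum_(i <- int_range N) F (i - l%:Z) + \sum_(k < l) F (N%:Z - k%:Z).
Proof.
move=> F0; elim: l => [|l IH].
  by rewrite big_ord0 addr0; apply: eq_bigr => i _; rewrite subr0.
rewrite IH big_ord_recr /= [X in _ = _ + X]addrC addrA; congr (_ + _).
have := @big_ord_recr _ _ +%R N.*2.+1 (fun k => F (k%:Z - N%:Z - l.+1%:Z)).
rewrite big_ord_recl /= F0 ?add0r; last by lia.
rewrite !int_rangeE => E; rewrite (_ : F (N%:Z - _) = F (N.*2.+1%:Z - N%:Z - l.+1%:Z)).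
  by rewrite -E; apply: eq_bigr => i _; congr F; rewrite /bump; lia.
by congr F; lia.
Qed.

Section Fock.
Variable M : neutral_fermions.
Implicit Types (u v w : fock M) (m n i j k l : int).

Definition fermi n v : fock M := lact (phi M n) v.

Lemma fermi_linear n : linear (fermi n).
Proof. by case: (lactP M) => h _ _ _; exact: h. Qed.

Lemma lact_linearl v : linear ((@lact M)^~ v).
Proof. by case: (lactP M) => _ h _ _; exact: h. Qed.

Lemma lactM X Y v : lact (X * Y) v = lact X (lact Y v) :> fock M.
Proof. by case: (lactP M) => _ _ _ h; exact: h. Qed.

Lemma lact1 v : lact 1 v = v.
Proof. by case: (lactP M) => _ _ h _; exact: h. Qed.

Definition word (s : seq int) : fock M := lact (\prod_(n <- s) phi M n) (vac M).

Lemma word_nil : word [::] = vac M.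
Proof. by rewrite /word big_nil lact1. Qed.

Lemma word_cons n s : word (n :: s) = fermi n (word s).
Proof. by rewrite /word big_cons lactM. Qed.

Lemma fermi_anticomm m n v :
  fermi m (fermi n v) = (2 * (-1) ^ m * (m + n == 0)%:R) *: v - fermi n (fermi m v).
Proof.
apply/eqP; rewrite eq_sym subr_eq /fermi -!lactM -(linD (lact_linearl v)).
by have [-> _] := algP M; rewrite (linZ (lact_linearl v)) lact1.
Qed.

Lemma fermi_swap m n v : m + n != 0 -> fermi m (fermi n v) = - fermi n (fermi m v).
Proof. by move=> mn; rewrite fermi_anticomm (negbTE mn) mulr0 scale0r sub0r. Qed.

Lemma fermi_vac n : n < 0 -> fermi n (vac M) = 0.
Proof. by move=> n0; rewrite -[n]opprK; apply: vac_annihilated; rewrite oppr_gt0. Qed.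

Lemma fermi0K v : fermi 0 (fermi 0 v) = v.
Proof.
have := fermi_anticomm 0 0 v; rewrite addr0 eqxx !mulr1 => /eqP.
rewrite -subr_eq opprK -mulr2n -scaler_nat -subr_eq0 -scalerBr scaler_eq0.
by rewrite (negbTE (@Qbeta_natr_neq0 2 _))//= subr_eq0 => /eqP.
Qed.

Lemma fermiK n v : n != 0 -> fermi n (fermi n v) = 0.
Proof.
move=> n0; have /eqP : fermi n (fermi n v) = - fermi n (fermi n v).
  by apply: fermi_swap; lia.
rewrite -subr_eq0 opprK -mulr2n -scaler_nat scaler_eq0.
by rewrite (negbTE (@Qbeta_natr_neq0 2 _))//= => /eqP.
Qed.

Lemma fock_rec (T : fock M -> Prop) : T (vac M) ->
  (forall a u v, T u -> T v -> T (a *: u + v)) ->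
  (forall n v, T v -> T (fermi n v)) -> forall v, T v.
Proof.
move=> Tvac TD Tf v; have [sp _] := fock_basis M.
have T0 : T 0 by rewrite -(addNr (vac M)) -scaleN1r; exact: TD.
apply: (in_span_lift T0 TD _ (sp v)) => s _; rewrite -/(word s).
elim: s => [|n s IH]; first by rewrite word_nil.
by rewrite word_cons; exact: Tf.
Qed.

(** Negative modes kill the vacuum, and passing [fermi k] causes no contraction once [n + k] is
    nonzero; hence the bound grows by the absolute value of [k] with each letter. *)
Lemma fermi_locally_finite v : exists N : nat, forall n, n < - N%:Z -> fermi n v = 0.
Proof.
elim/fock_rec: v => [|a u v [N1 h1] [N2 h2]|k v [N h]].
- by exists 0%N => n; rewrite oppr0; exact: fermi_vac.
- exists (N1 + N2)%N => n nN.
  by rewrite (fermi_linear n) h1 ?h2 ?scaler0 ?addr0//; lia.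
- exists (N + `|k|)%N => n nN; rewrite fermi_swap; last by lia.
  by rewrite h ?(lin0 (fermi_linear k)) ?oppr0//; lia.
Qed.

Definition b_term m i v : fock M := (-1) ^ i *: fermi (- i - m) (fermi i v).

Lemma b_term_linear m i : linear (b_term m i).
Proof.
by apply: linear_scale; apply: linear_comp; exact: fermi_linear.
Qed.

(** For [i] very negative the right factor kills [v]; for [i] very positive the left one does, after
    a swap. The two indices add up to [- m], so for nonzero [m] the swap is free; at [m = 0] it
    would leave the constant 2 for every large [i]. *)
Lemma b_term_locally_finite m v : m != 0 ->
  exists N : nat, forall i, (N < `|i|)%N -> b_term m i v = 0.
Proof.
move=> m0; have [N h] := fermi_locally_finite v.
exists (N + `|m|)%N => i iN; rewrite /b_term.
case: (ltP i 0) => i0.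
  by rewrite h ?(lin0 (fermi_linear _)) ?scaler0//; lia.
rewrite fermi_swap; last by lia.
by rewrite h ?(lin0 (fermi_linear _)) ?oppr0 ?scaler0//; lia.
Qed.

Lemma b_fockE m v (N : nat) : (forall i, (N < `|i|)%N -> b_term m i v = 0) ->
  b_fock m v = 4^-1 *: \sum_(i <- int_range N) b_term m i v.
Proof.
move=> h; rewrite /b_fock (@fsum_seq _ _ _ (int_range N)) ?int_range_uniq//; last first.
  by move=> i _; rewrite mem_int_range -ltnNge lactM; exact: h.
congr (_ *: _); rewrite big_mkcond; apply: eq_bigr => i _.
by rewrite ifT ?in_setT// lactM.
Qed.

Lemma b_fock_large m (vs : seq (fock M)) : m != 0 -> exists N : nat, forall N', (N <= N')%N ->
  forall v, v \in vs -> b_fock m v = 4^-1 *: \sum_(i <- int_range N') b_term m i v.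
Proof.
move=> m0; elim: vs => [|v vs [N IH]]; first by exists 0%N.
have [N0 h] := b_term_locally_finite v m0.
exists (N0 + N)%N => N' le w; rewrite inE => /orP[/eqP ->|wvs].
  by apply: b_fockE => i iN; apply: h; lia.
by apply: IH => //; lia.
Qed.

Lemma b_fock_linear m : m != 0 -> linear (b_fock (M:=M) m).
Proof.
move=> m0 a u v; have [N h] := b_fock_large [:: a *: u + v; u; v] m0.
rewrite !(h N (leqnn N)) ?inE ?eqxx ?orbT//.
apply: (@linear_scale _ _ _ (fun u => \sum_(i <- _) b_term m i u)).
by apply: linear_sum => i; exact: b_term_linear.
Qed.

(** Exactly two indices contract with [n], namely [i = - n] and [i = n - m]. Each contributes 2,
    which absorbs the factor 1/4; the signs agree because [m] is odd. The window [N'] is wide enough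
    to contain both. *)
Lemma b_fock_fermi m n v : odd `|m|%N ->
  b_fock m (fermi n v) = fermi n (b_fock m v) + fermi (n - m) v.
Proof.
move=> om; have m0 : m != 0 by lia.
have [N h] := b_fock_large [:: fermi n v; v] m0.
set N' := (N + `|n| + `|m|)%N.
rewrite !(h N') ?inE ?eqxx ?orbT//; try by rewrite /N'; lia.
rewrite (linZ (fermi_linear n)) (lin_sum (fermi_linear n)).
have E i : b_term m i (fermi n v) = fermi n (b_term m i v) +
     ((2 * (i + n == 0)%:R) *: fermi (n - m) v + (2 * (n - i - m == 0)%:R) *: fermi (n - m) v).
  rewrite /b_term (fermi_anticomm i n) (linD (fermi_linear _)).
  rewrite (linZ (fermi_linear _)) (linN (fermi_linear _)) (fermi_anticomm (- i - m) n).
  rewrite (linZ (fermi_linear n)) opprB !scalerDr addrCA; congr (_ + _).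
  rewrite scalerN !scalerA; congr (_ + _).
    case: eqP => [e|_]; last by rewrite !mulr0 !scale0r.
    have -> : - i - m = n - m by lia.
    by rewrite !mulr1 mulrCA sgnz_sqr mulr1.
  have -> : (- i - m + n == 0) = (n - i - m == 0) by lia.
  case: eqP => [e|_]; last by rewrite !mulr0 !scale0r oppr0.
  have -> : i = n - m by lia.
  rewrite !mulr1 mulrCA -sgnzD; have -> : n - m + (- (n - m) - m) = - m by lia.
  by rewrite sgnzN sgnz_odd// mulrN1 scaleNr opprK.
rewrite (eq_bigr _ (fun i _ => E i)) big_split scalerDr; congr (_ + _).
rewrite big_split /= (@int_range_sum _ _ _ (- n)); first last.
- by move=> i /eqP ni; case: eqP => [|_]; [lia|rewrite mulr0 scale0r].
- by rewrite /N'; lia.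
rewrite (@int_range_sum _ _ _ (n - m)); first last.
- by move=> i /eqP ni; case: eqP => [|_]; [lia|rewrite mulr0 scale0r].
- by rewrite /N'; lia.
have -> : (- n + n == 0) by lia.
have -> : (n - (n - m) - m == 0) by lia.
rewrite -scalerDl scalerA -mulrDr -natrD mulrC -natrM mulfV ?scale1r//.
exact: Qbeta_natr_neq0.
Qed.

Lemma b_fock_vac m : 0 < m -> b_fock m (vac M) = 0.
Proof.
move=> m0; rewrite (@b_fockE _ _ 0%N); last first.
  move=> i _; rewrite /b_term; case: (ltP i 0) => i0.
    by rewrite fermi_vac// (lin0 (fermi_linear _)) scaler0.
  rewrite fermi_swap; last by lia.
  by rewrite fermi_vac ?(lin0 (fermi_linear _)) ?oppr0 ?scaler0//; lia.
rewrite big_seq1 /b_term fermi_swap; last by lia.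
by rewrite (@fermi_vac (_ - m)) ?(lin0 (fermi_linear _)) ?oppr0 ?scaler0//; lia.
Qed.


(* By [b_l, phi_j] = phi_(j - l) both halves of the action on the sum b_(-m)|0> are the same
   sum, shifted by l with the opposite sign; only the boundary terms survive. *)
Lemma bracket_vac (l m : nat) : odd l -> odd m ->
  b_fock l%:Z (b_fock (- m%:Z) (vac M)) = (l%:R / 2 * (l == m)%:R) *: vac M.
Proof.
move=> ol om.
have m0 : - m%:Z != 0 by lia.
have l0 : l%:Z != 0 by lia.
have [N h] := b_fock_large [:: vac M] m0.
set N' := (N + l + m)%N.
rewrite (h N') ?inE//; last by rewrite /N'; lia.
rewrite (linZ (b_fock_linear l0)) (lin_sum (b_fock_linear l0)).
pose W a b := fermi a (fermi b (vac M)).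
pose F (i : int) : fock M := (-1) ^ i *: W (m%:Z - l%:Z - i) i.
have E i : b_fock l%:Z (b_term (- m%:Z) i (vac M)) = F i - F (i - l%:Z).
  rewrite /b_term (linZ (b_fock_linear l0)) !b_fock_fermi// b_fock_vac; last by lia.
  rewrite (lin0 (fermi_linear _)) add0r scalerDr addrC /F /W.
  have -> : m%:Z - l%:Z - (i - l%:Z) = - i - - m%:Z by lia.
  have -> : m%:Z - l%:Z - i = - i - - m%:Z - l%:Z by lia.
  rewrite sgnzD sgnzN (@sgnz_odd l%:Z); last by lia.
  by rewrite mulrN1 scaleNr !opprK.
have F0 i : i < 0 -> F i = 0.
  by move=> i0; rewrite /F /W fermi_vac// (lin0 (fermi_linear _)) scaler0.
rewrite (eq_bigr _ (fun i _ => E i)) sumrB (@int_range_shift _ N' l); last first.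
  by move=> i iN; apply: F0; lia.
rewrite addrAC subrr add0r.
(* The surviving [i] are so large that [m - l - i] is negative: that mode kills the vacuum once
   moved past [fermi i], and the contraction gives 2 exactly when [l = m]. The [l] terms and the
   factor 1/4 make l/2. *)
have FN (k : 'I_l) : F (N'%:Z - k%:Z) = (2 * (l == m)%:R) *: vac M.
  rewrite /F /W; set i := _ - k%:Z; have := ltn_ord k => kl.
  have iN : (N + m)%N%:Z < i by rewrite /i /N'; lia.
  have [e|ne] := eqVneq l m.
    rewrite fermi_anticomm fermi_vac; last by lia.
    rewrite (lin0 (fermi_linear _)) subr0 scalerA.
    have -> : m%:Z - l%:Z - i + i == 0 by lia.
    rewrite !mulr1 mulrCA -sgnzD; have -> : i + (m%:Z - l%:Z - i) = 0 by lia.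
    by rewrite expr0z mulr1.
  rewrite fermi_swap; last by lia.
  by rewrite fermi_vac ?(lin0 (fermi_linear _)) ?oppr0 ?scaler0 ?mulr0 ?scale0r//; lia.
rewrite (eq_bigr _ (fun x _ => FN x)) sumr_const card_ord -scaler_nat !scalerA.
congr (_ *: _); rewrite -mulrA mulrCA quarter_double; last exact: Qbeta_natr_neq0.
by congr (_ * _); rewrite mulrC.
Qed.

(* The commutator commutes with every phi_n, so it is the scalar read off on the vacuum. *)
Lemma b_fock_bracket (l m : nat) v : odd l -> odd m ->
  b_fock l%:Z (b_fock (- m%:Z) v) =
  b_fock (- m%:Z) (b_fock l%:Z v) + (l%:R / 2 * (l == m)%:R) *: v.
Proof.
move=> ol om.
have m0 : - m%:Z != 0 by lia.
have l0 : l%:Z != 0 by lia.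
elim/fock_rec: v => [|a u v IHu IHv|n v IH].
- rewrite bracket_vac// b_fock_vac ?(lin0 (b_fock_linear m0)) ?add0r//; lia.
- rewrite !(b_fock_linear m0, b_fock_linear l0) IHu IHv.
  move: (b_fock _ _) (b_fock _ _) => x y.
  by rewrite !scalerDr !scalerA (mulrC a) addrACA.
have om' : odd `|- m%:Z|%N by lia.
rewrite !b_fock_fermi// (linD (b_fock_linear l0)) (linD (b_fock_linear m0)) !b_fock_fermi//.
rewrite IH (linD (fermi_linear n)).
have -> : n - l%:Z - - m%:Z = n - - m%:Z - l%:Z by lia.
rewrite -!addrA; congr (_ + _); rewrite addrC -!addrA addrCA.
by do 3!congr (_ + _); rewrite (linZ (fermi_linear n)).
Qed.

Lemma covac_fermi n v : 0 < n -> pairing (covac M) (fermi n v) = 0.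
Proof.
move=> n0; rewrite -pairing_act covac_annihilated//.
exact: (@lin0 _ Qbeta^o _ (pairing_linear_l v)).
Qed.

Lemma covac_lin : linear (pairing (covac M) : fock M -> Qbeta^o).
Proof. exact: pairing_linear_r. Qed.

Lemma covac_b (m : nat) v : odd m -> pairing (covac M) (b_fock (- m%:Z) v) = 0.
Proof.
move=> om; have m0 : - m%:Z != 0 by lia.
have [N h] := b_fock_large [:: v] m0.
rewrite (h N) ?inE// (linZ covac_lin) (lin_sum covac_lin) big1 ?scaler0// => i _.
rewrite (linZ covac_lin); case: (ltP 0 i) => i0; last first.
  by rewrite covac_fermi ?scaler0//; lia.
rewrite fermi_swap; last by lia.
by rewrite (linN covac_lin) covac_fermi// oppr0 scaler0.
Qed.

(** The commutator of b_l with phi_n is phi_(n-l), which kills a given vector once l is large. This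
    is why the infinite series b^[beta]_n acts on every vector as a finite sum. *)
Lemma b_locally_nilpotent v : exists N : nat, forall l : nat, odd l -> (N < l)%N ->
  b_fock l%:Z v = 0.
Proof.
elim/fock_rec: v => [|a u v [N1 h1] [N2 h2]|n v [N h]].
- by exists 0%N => l _ l0; apply: b_fock_vac; lia.
- exists (N1 + N2)%N => l ol lN.
  rewrite b_fock_linear; last by lia.
  by rewrite h1 ?h2 ?scaler0 ?addr0//; lia.
have [N0 h0] := fermi_locally_finite v.
exists (N + N0 + `|n|)%N => l ol lN; rewrite b_fock_fermi//.
by rewrite h ?(lin0 (fermi_linear n)) ?add0r ?h0//; lia.
Qed.

(** * The vacuum pairing and adjoints *)

Definition bracket_form w v : Qbeta := pairing (star_fock w) v.

Lemma ractM (x : dual_fock M) X Y : ract x (X * Y) = ract (ract x X) Y.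
Proof. by case: (ractP M) => _ _ _ h; exact: h. Qed.

Lemma ract_linear (x : dual_fock M) : linear (@ract M x).
Proof. by case: (ractP M) => _ h _ _; exact: h. Qed.

(** The map [star_fock] is described only on vectors of the form X|0>; cyclicity of the vacuum lets
    its linearity and its compatibility with the action be read off from [star] on the algebra. *)
Lemma lact_vac_surj v : exists X, v = lact X (vac M).
Proof.
elim/fock_rec: v => [|a u v [X ->] [Y ->]|n v [X ->]].
- by exists 1; rewrite lact1.
- by exists (a *: X + Y); rewrite (lact_linearl (vac M)).
by exists (phi M n * X); rewrite lactM.
Qed.

Lemma star_fock_linear : linear (@star_fock M).
Proof.
move=> a u v; have [X ->] := lact_vac_surj u; have [Y ->] := lact_vac_surj v.
rewrite -(lact_linearl (vac M)) !star_fockE (@star_linear M).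
exact: ract_linear.
Qed.

Lemma star_dual_linear : linear (@star_dual M).
Proof.
move=> a x y; apply: (can_inj (@star_fockK M)).
by rewrite star_fock_linear !star_dualK.
Qed.

Lemma star_dual_act v X : star_dual (ract (star_fock v) X) = lact (star X) v.
Proof.
have [Y ->] := lact_vac_surj v.
rewrite star_fockE -ractM star_dualE starM !lactM; congr lact.
by rewrite -star_dualE -star_fockE star_fockK.
Qed.

Lemma star_fock_act v X : star_fock (lact X v) = ract (star_fock v) (star X).
Proof.
by have [Y ->] := lact_vac_surj v; rewrite -lactM !star_fockE starM ractM.
Qed.

Lemma star_fock_vac : star_fock (vac M) = covac M.
Proof.
rewrite -[vac M]lact1 star_fockE star1; by case: (ractP M) => _ _ h _; exact: h.
Qed.

Lemma bracket_form_linearr w : linear (bracket_form w : fock M -> Qbeta^o).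
Proof. exact: pairing_linear_r. Qed.

Lemma bracket_form_linearl v : linear (bracket_form^~ v : fock M -> Qbeta^o).
Proof.
move=> a u w; rewrite /bracket_form star_fock_linear.
exact: (pairing_linear_l v).
Qed.

Lemma bracket_formZl a w v : bracket_form (a *: w) v = a * bracket_form w v.
Proof. exact: (linZ (bracket_form_linearl v)). Qed.

Lemma bracket_formZr a w v : bracket_form w (a *: v) = a * bracket_form w v.
Proof. exact: (linZ (bracket_form_linearr w)). Qed.

Lemma bracket_form_suml I (r : seq I) (F : I -> fock M) v :
  bracket_form (\sum_(x <- r) F x) v = \sum_(x <- r) bracket_form (F x) v.
Proof. exact: (lin_sum (bracket_form_linearl v)). Qed.

Lemma bracket_form_sumr I (r : seq I) (F : I -> fock M) w :
  bracket_form w (\sum_(x <- r) F x) = \sum_(x <- r) bracket_form w (F x).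
Proof. exact: (lin_sum (bracket_form_linearr w)). Qed.

Lemma bracket_form_fermi n w v :
  bracket_form (fermi n w) v = (-1) ^ n * bracket_form w (fermi (- n) v).
Proof.
rewrite /bracket_form star_fock_act star_phi pairing_act (linZ (lact_linearl v)).
exact: bracket_formZr.
Qed.

(** After [i] is replaced by [- i], the two modes stand in the wrong order. The sign of the swap
    cancels against the signs of the two adjoints, whose contribution is (-1)^l = -1. *)
Lemma bracket_form_b (l : nat) w v : odd l ->
  bracket_form (b_fock (- l%:Z) w) v = bracket_form w (b_fock l%:Z v).
Proof.
move=> ol; have l0 : l%:Z != 0 by lia.
have l0' : - l%:Z != 0 by lia.
have [N1 h1] := b_fock_large [:: w] l0'; have [N2 h2] := b_fock_large [:: v] l0.
rewrite (h1 (N1 + N2)%N) ?inE ?leq_addr// (h2 (N1 + N2)%N) ?inE ?leq_addl//.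
rewrite bracket_formZl bracket_formZr bracket_form_suml bracket_form_sumr.
congr (_ * _); rewrite [RHS]int_range_opp; apply: eq_bigr => i _.
rewrite /b_term bracket_formZl bracket_formZr !bracket_form_fermi.
rewrite fermi_swap; last by lia.
rewrite -scaleN1r bracket_formZr !mulrA; congr (_ * bracket_form _ (fermi _ _)); last by lia.
rewrite -mulrA -!sgnzD sgnzN (_ : i + _ = l%:Z); last by lia.
by rewrite sgnz_odd// mulN1r mulrN1 opprK.
Qed.

(** The reindexing [i + l] is a bijection of the integers and [star_dual] is injective, so the
    supports correspond and the sums on the dual side require no finiteness argument of their
    own. *)
Lemma star_dual_b (l : int) v : star_dual (b_dual (star_fock v) l) = b_fock (- l) v.
Proof.
rewrite /b_dual (linZ star_dual_linear) (lin_fsum star_dual_linear); last first.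
  exact: can_inj (@star_dualK M).
congr (_ *: _); rewrite [RHS](@reindex_fsbigT _ _ _ _ _ (fun i : int => i + l)); last first.
  by exists (fun i => i - l) => i; [exact: addrK|exact: subrK].
apply: eq_fsbigr => i _; rewrite (linZ star_dual_linear) star_dual_act.
rewrite starM !star_phi -scalerAl -scalerAr !(linZ (lact_linearl v)) !scalerA.
rewrite sgnz_sqr mul1r -sgnzN (_ : - (- i - l) = i + l); last by lia.
by rewrite (_ : - (i + l) - - l = - i); last by lia.
Qed.

Lemma b_braE (n : int) v :
  b_bra n v = \sum_(l \in odd_int) bcoef (- n) l *: b_fock (- l) v.
Proof.
rewrite /b_bra /b_beta_dual (lin_fsum star_dual_linear); last exact: can_inj (@star_dualK M).
by apply: eq_fsbigr => l _; rewrite (linZ star_dual_linear) star_dual_b.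
Qed.

(** * Deformed modes as finite combinations of odd modes *)

Definition b_comb (c : nat -> Qbeta) (K : nat) v : fock M :=
  \sum_(x < K) c x.*2.+1 *: b_fock x.*2.+1%:Z v.

(** The unit [e] is 1 or -1 and selects the half line carrying the sum: positive indices for
    b^(beta)_n, negative ones for b^[beta]_n. *)
Lemma odd_int_sum (V : nmodType) (K : nat) (e : int) (F : int -> V) :
  e * e = 1 ->
  (forall l : int, odd `|l|%N -> (e * l < 0) || (K.*2 < `|l|)%N -> F l = 0) ->
  \sum_(l \in odd_int) F l = \sum_(x < K) F (e * x.*2.+1%:Z).
Proof.
move=> ee F0; rewrite (@fsum_seq _ _ _ [seq e * x.*2.+1%:Z | x <- iota 0 K]).
- rewrite big_map -(big_mkord xpredT (fun x => F (e * x.*2.+1%:Z))) /index_iota subn0.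
  apply: eq_bigl => j; apply/asboolP; rewrite /odd_int /= abszM absz_nat /=.
  have -> : `|e|%N = 1%N by nia.
  by rewrite mul1n /= odd_double.
- rewrite map_inj_in_uniq ?iota_uniq// => i j _ _ /(congr1 ( *%R e)).
  by rewrite !mulrA ee; lia.
move=> l /asboolP ol; move/negP => h; apply: F0 => //.
apply/orP; case: (ltP (e * l) 0) => [|el]; first by left.
right; rewrite ltnNge; apply/negP => lK; apply: h; apply/mapP.
have e1 : `|e|%N = 1%N by nia.
have oel : odd `|l|%N by [].
exists (`|l|./2)%N; first by rewrite mem_iota; lia.
have -> : (`|l|./2.*2.+1 = `|l|)%N by lia.
nia.
Qed.

Lemma gen_binom_nat (n d : nat) : (n < d)%N -> gen_binom n%:Z d = 0.
Proof.
move=> nd; rewrite /gen_binom (bigD1 (Ordinal nd))//= -[n%:Z%:~R]/(n%:R).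
by rewrite subrr !mul0r.
Qed.

Lemma b_beta_comb (n : nat) v : (0 < n)%N -> exists K0 : nat, forall K : nat, (K0 <= K)%N ->
  b_beta n%:Z v = b_comb (fun x => bcoef n%:Z x%:Z) K v.
Proof.
move=> n0; have [N h] := b_locally_nilpotent v; exists N => K NK.
rewrite /b_beta (@odd_int_sum _ K 1)//.
  by apply: eq_bigr => x _; rewrite mul1r.
move=> l ol; rewrite mul1r; case: (ltP l 0) => [l0 _|l0 /= lK]; last first.
  have -> : l = `|l|%N%:Z by lia.
  by rewrite h ?scaler0//; lia.
(* For [l < 0] the binomial has lower index [n - l] beyond [n] and vanishes: a nonnegative power
   expands to a polynomial. *)
have ln : l <= n%:Z by lia.
rewrite /bcoef /shift_coef ln gen_binom_nat; last by lia.
by rewrite !mul0r mulr0 subrr mul0r scale0r.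
Qed.

Lemma b_bra_comb (n : nat) v : (0 < n)%N -> exists K0 : nat, forall K : nat, (K0 <= K)%N ->
  b_bra n%:Z v = b_comb (fun x => bcoef (- n%:Z) (- x%:Z)) K v.
Proof.
move=> n0; have [N h] := b_locally_nilpotent v; exists N => K NK.
rewrite b_braE (@odd_int_sum _ K (-1))//.
  by apply: eq_bigr => x _; rewrite mulN1r opprK.
move=> l ol; rewrite mulN1r; case: (ltP (- l) 0) => [l0 _|l0 /= lK]; last first.
  have -> : - l = `|l|%N%:Z by lia.
  by rewrite h ?scaler0//; lia.
rewrite /bcoef /shift_coef; case: ifP => [|_]; first by lia.
by rewrite mulr0 subrr mul0r scale0r.
Qed.
End Fock.

(** * The factor z_lambda *)

Lemma zee_subset (la t : seq nat) : uniq t -> {subset la <= t} ->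
  zee la = (\prod_(i <- t) (i ^ count_mem i la * (count_mem i la)`!))%N.
Proof.
move=> ut st; rewrite /zee [RHS](bigID (mem la)) /= [X in (_ * X)%N]big1 ?muln1; last first.
  by move=> i /count_memPn ->; rewrite expn0.
rewrite -[RHS]big_filter; apply: perm_big; apply: uniq_perm.
- exact: undup_uniq.
- exact: filter_uniq.
by move=> i; rewrite mem_undup mem_filter; case: (boolP (i \in la)) => // /st ->.
Qed.

(** The part times its new multiplicity is, up to 1/2, the scalar picked up when b_l moves through
    b_(-mu), which makes the norm computation an induction on parts. *)
Lemma zee_cons l la : zee (l :: la) = (l * (count_mem l la).+1 * zee la)%N.
Proof.
have ut := undup_uniq (l :: la); have lt : l \in undup (l :: la) by rewrite mem_undup inE eqxx.
rewrite (@zee_subset la (undup (l :: la))) ?undup_uniq//; last first.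
  by move=> i il; rewrite mem_undup inE il orbT.
rewrite {1}/zee !(bigD1_seq l)//= eqxx add1n expnS factS.
rewrite [RHS]mulnA; congr (_ * _)%N; first by rewrite mulnACA.
by apply: eq_bigr => i; rewrite eq_sym => /negbTE ->.
Qed.

Lemma zee_gt0 la : all odd la -> (0 < zee la)%N.
Proof.
elim: la => [|l la IH] /=; first by rewrite /zee big_nil.
by case/andP => ol ola; rewrite zee_cons !muln_gt0 IH//= andbT; lia.
Qed.

(** * Straightening and parity *)

Definition strict_word (N d : int) (e : bool) (s : seq int) : bool :=
  [&& fock_word s, all (fun a => a < N) s, \sum_(a <- s) a == d & odd (size s) == e].

Definition graded_word (d : int) (e : bool) (s : seq int) : bool :=
  [&& fock_word s, \sum_(a <- s) a == d & odd (size s) == e].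

Lemma fock_word_cons (n : int) t :
  fock_word (n :: t) = [&& 0 <= n, fock_word t & all (fun a => a < n) t].
Proof.
rewrite /fock_word /= path_sortedE; last by move=> a b c; lia.
by case: (0 <= n); case: sorted; rewrite /= ?andbF// andbT andbC.
Qed.

Definition parity_word (e : bool) s := fock_word s && (odd (size s) == e).

Section Parity.
Variable M : neutral_fermions.
Implicit Types (u v w : fock M) (s t : seq int).

(* The bound N on the letters is what keeps a larger letter prepended in the induction in
   front of a strictly decreasing word. *)
Lemma fermi_strict_word t (N n : int) : fock_word t -> all (fun a => a < N) t -> n < N ->
  in_span (strict_word N (n + \sum_(a <- t) a) (~~ odd (size t))) (word M)
    (fermi n (word M t)).
Proof.
elim: t N n => [|m t IH] N n.
  move=> _ _ nN; case: (ltP n 0) => n0.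
    by rewrite word_nil fermi_vac//; exact: in_span0.
  rewrite -word_cons; apply: in_span_gen.
  by rewrite /strict_word fock_word_cons n0 /= nN big_cons big_nil !eqxx.
rewrite fock_word_cons => /and3P[m0 ft tm] /= /andP[mN tN] nN.
have [nm|nm|e] := ltgtP n m.
(* The contraction survives only for [n = - m]; dropping both letters keeps the degree and the
   parity. *)
- rewrite word_cons fermi_anticomm -scaleN1r [X in in_span _ _ X]addrC; apply: in_span_lin; last first.
    case: (n + m =P 0) => [nm0|_]; last by rewrite mulr0 scale0r; exact: in_span0.
    apply/in_spanZ/in_span_gen; rewrite /strict_word ft tN /= negbK eqxx andbT.
    by rewrite big_cons; lia.
  apply: in_span_map (fermi_linear m) _ _ (IH m n ft tm nm) => s.
  case/and4P => fs sm /eqP ds /eqP es; rewrite -word_cons; apply: in_span_gen.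
  rewrite /strict_word fock_word_cons m0 fs sm /= mN !big_cons ds es eqxx andbT /=.
  rewrite (_ : m + _ == _); last by lia.
  by rewrite andbT; apply: sub_all sm => a /lt_trans; exact.
- rewrite -word_cons; apply: in_span_gen; rewrite /strict_word !fock_word_cons m0 ft tm.
  rewrite /= nN mN tN !big_cons nm eqxx; rewrite eqxx !andbT; apply/andP; split; first by lia.
  by apply: sub_all tm => a am; exact: lt_trans nm.
rewrite -e word_cons {e m m0 tm mN}.
have [->|n0] := eqVneq n 0.
  rewrite fermi0K; apply: in_span_gen; rewrite /strict_word ft tN /= negbK eqxx andbT.
  by rewrite big_cons !add0r.
by rewrite fermiK//; exact: in_span0.
Qed.

Lemma graded_fermi (n d : int) e v : in_span (graded_word d e) (word M) v ->
  in_span (graded_word (n + d) (~~ e)) (word M) (fermi n v).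
Proof.
apply: in_span_map (fermi_linear n) _ _ => s /and3P[fs /eqP <- /eqP <-].
pose N := `|n| + 1 + \sum_(a <- s) `|a|.
have sN : all (fun a => a < N) s.
  apply/allP => a sa; rewrite /N (big_rem a)//=.
  have h : 0 <= \sum_(y <- rem a s) `|y| by apply: sumr_ge0.
  move: h; move: (\sum_(y <- rem a s) _) => S h; lia.
have nN : n < N.
  have h : 0 <= \sum_(y <- s) `|y| by apply: sumr_ge0.
  by rewrite /N; lia.
apply: in_span_sub (fermi_strict_word fs sN nN) => t /and4P[ft _ dt et].
by rewrite /graded_word ft dt et.
Qed.

Lemma graded_vac : in_span (graded_word 0 false) (word M) (vac M).
Proof. by rewrite -word_nil; apply: in_span_gen; rewrite /graded_word big_nil. Qed.

Lemma graded_b (m d : int) e v : m != 0 -> in_span (graded_word d e) (word M) v ->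
  in_span (graded_word (d - m) e) (word M) (b_fock m v).
Proof.
move=> m0 gv; have [N h] := b_fock_large [:: v] m0.
rewrite (h N) ?inE//; apply/in_spanZ/in_span_sum => i _; apply: in_spanZ.
rewrite (_ : d - m = - i - m + (i + d)); last by lia.
by rewrite -[e]negbK; apply/graded_fermi/graded_fermi.
Qed.

Notation parity e := (in_span (parity_word e) (word M)).

Lemma parity_fermi n e v : parity e v -> parity (~~ e) (fermi n v).
Proof.
apply: in_span_map (fermi_linear n) _ _ => s /andP[fs es].
have gs : graded_word (\sum_(a <- s) a) e s by rewrite /graded_word fs es eqxx.
apply: in_span_sub (graded_fermi n (in_span_gen _ gs)) => t /and3P[ft _ et].
by rewrite /parity_word ft et.
Qed.

Lemma parity_b m e v : m != 0 -> parity e v -> parity e (b_fock m v).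
Proof.
move=> m0 gv; have [N h] := b_fock_large [:: v] m0.
rewrite (h N) ?inE//; apply/in_spanZ/in_span_sum => i _; apply: in_spanZ.
by rewrite -[e]negbK; apply/parity_fermi/parity_fermi.
Qed.

(** An odd basis word either starts with a positive letter, which <0| kills, or is the single letter
    0, where <0|phi_0|0> = 0 applies. *)
Lemma covac_parity v : parity true v -> pairing (covac M) v = 0.
Proof.
apply: (in_span_lift (T := fun x => pairing (covac M) x = 0)) => [|a u w u0 w0|s].
- exact: (lin0 (covac_lin (M := M))).
- by rewrite (covac_lin (M := M)) u0 w0 scaler0 addr0.
case: s => [//|n s] /andP[/andP[so /andP[n0 s0]] es]; rewrite word_cons.
have [n1|n1] := ltP 0 n; first exact: covac_fermi.
have e0 : n = 0 by lia.
case: s so s0 es => [_ _ _|m s /= /andP[mn _] /andP[m0 _] _]; last by lia.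
by rewrite word_nil e0; exact: pairing_phi0.
Qed.

(** Each letter of [w] moved across the pairing flips the parity of the other side, so that <0|
    finally meets an odd vector. *)
Lemma bracket_form_parity e w v : parity e w -> parity (~~ e) v -> bracket_form w v = 0.
Proof.
move=> pw pv; move: w pw; apply: (in_span_lift (T := fun x => bracket_form x v = 0)) => [|a u w u0 w0|s].
- exact: (lin0 (bracket_form_linearl v)).
- by rewrite (bracket_form_linearl v) u0 w0 scaler0 addr0.
case/andP => _ /eqP es; move: pv; rewrite -es {e es}; elim: s v => [|n s IH] v pv.
  by rewrite word_nil /bracket_form star_fock_vac covac_parity.
rewrite /= negbK in pv.
by rewrite word_cons bracket_form_fermi IH ?mulr0//; exact: parity_fermi.
Qed.

Lemma parity_split v : exists v0 v1, [/\ v = v0 + v1, parity false v0 & parity true v1].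
Proof.
have [sp _] := fock_basis M; move: v (sp v).
apply: (in_span_lift (T := fun x => exists v0 v1,
  [/\ x = v0 + v1, parity false v0 & parity true v1])) => [|a _ _ [u0 [u1 [-> pu0 pu1]]] [v0 [v1 [-> pv0 pv1]]]|s fs].
- by exists 0, 0; rewrite addr0; split => //; exact: in_span0.
- exists (a *: u0 + v0), (a *: u1 + v1); split; try exact: in_span_lin.
  by rewrite scalerDr addrACA.
rewrite -/(word M s); case es : (odd (size s)).
  exists 0, (word M s); rewrite add0r; split => //; first exact: in_span0.
  by apply: in_span_gen; rewrite /parity_word fs es.
exists (word M s), 0; rewrite addr0; split => //; last exact: in_span0.
by apply: in_span_gen; rewrite /parity_word fs es.
Qed.

Lemma fock_even_parity v : fock_even v -> parity false v.
Proof. by apply: in_span_sub => s /andP[fs es]; rewrite /parity_word fs eqbF_neg. Qed.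

Definition bword (mu : seq nat) : fock M :=
  foldr (fun l => b_fock (- l%:Z)) (vac M) mu.

Lemma graded_bword mu : all odd mu ->
  in_span (graded_word (sumn mu)%:Z false) (word M) (bword mu).
Proof.
elim: mu => [_|l mu IH /= /andP[ol omu]]; first exact: graded_vac.
rewrite (_ : (l + sumn mu)%N%:Z = (sumn mu)%:Z - - l%:Z); last by lia.
by apply: graded_b; [lia|exact: IH].
Qed.


(* Moving b_l through b_(-mu) removes one part equal to l for each occurrence of l in mu;
   the prefix al collects the parts already passed. *)
Lemma bracket_form_bword_step w (l : nat) (x : Qbeta) (al mu : seq nat) :
  odd l -> all odd al -> all odd mu ->
  (forall be, perm_eq (l :: be) (al ++ mu) -> bracket_form w (bword be) = x) ->
  bracket_form w (foldr (fun l => b_fock (- l%:Z)) (b_fock l%:Z (bword mu)) al) =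
  l%:R / 2 * (count_mem l mu)%:R * x.
Proof.
move=> ol; have l0 : l%:Z != 0 by lia.
have lin_fold be : all odd be -> linear (fun u => foldr (fun l => b_fock (M := M) (- l%:Z)) u be).
  elim: be => [//|m be IH] /= /andP[om obe].
  by apply: linear_comp (IH obe) (b_fock_linear _); lia.
elim: mu al => [|m mu IH] al oal.
  move=> _ _ /=; rewrite b_fock_vac; last by lia.
  by rewrite (lin0 (lin_fold _ oal)) mulr0 mul0r (lin0 (bracket_form_linearr w)).
move=> /= /andP[om omu] H; rewrite b_fock_bracket//.
rewrite (linD (lin_fold _ oal)) (linZ (lin_fold _ oal) (_ * _)) (linD (bracket_form_linearr w)).
rewrite (bracket_formZr (_ * _)); cbv beta.
have := IH (rcons al m); rewrite foldr_rcons => ->; rewrite ?all_rcons ?om//; last first.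
  by move=> be; rewrite cat_rcons; exact: H.
rewrite natrD mulrDr mulrDl [RHS]addrC; congr (_ + _).
rewrite eq_sym; case: eqP => [e|_]; last by rewrite !mulr0 !mul0r.
rewrite -foldr_cat; congr (_ * _); apply: H.
by rewrite -e perm_sym -cat1s perm_catCA.
Qed.

(** Permutation equality replaces equality here because removing a part from [mu] leaves lists in
    any order, to which the induction hypothesis must apply. *)
Lemma bracket_form_bword (nu mu : seq nat) : all odd nu -> all odd mu ->
  bracket_form (bword nu) (bword mu) = 2 ^- size nu * (zee nu)%:R * (perm_eq nu mu)%:R.
Proof.
elim: nu mu => [|l nu IH] mu.
  move=> _; case: mu => [_|m mu /= /andP[om _]].
    by rewrite /bracket_form star_fock_vac pairing_vac /zee big_nil expr0 invr1 !mulr1.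
  rewrite /bracket_form star_fock_vac covac_b//.
  have -> : perm_eq [::] (m :: mu) = false by apply/negP => /perm_size.
    by rewrite mulr0.
move=> /= /andP[ol onu] omu; rewrite bracket_form_b//.
rewrite (@bracket_form_bword_step _ l
  (2 ^- size nu * (zee nu)%:R * (perm_eq (l :: nu) mu)%:R) [::])//; last first.
  move=> be pbe; rewrite IH//; last first.
    by move: omu; rewrite -(perm_all _ pbe) => /andP[].
  by rewrite -[perm_eq nu be](perm_cons l) (permPr pbe).
case: (boolP (perm_eq _ mu)) => [p|_]; last by rewrite !mulr0.
rewrite -(permP p) zee_cons /= eqxx add1n !mulr1 exprSr invfM !natrM.
rewrite -!mulrA [RHS]mulrCA -[in RHS](mulrCA l%:R) [RHS]mulrCA; do 2!congr (_ * _).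
exact: mulrCA.
Qed.

End Parity.

(** * The bosonic vectors span the even Fock space *)

(** Uniqueness of binary expansions: the lowest digit is the parity of the sum, and the remaining
    digits expand its half. The bound [N] turns both lists into digit vectors of one length. *)
Lemma binary_sum_inj (A B : seq nat) : uniq A -> uniq B ->
  (\sum_(k <- A) 2 ^ k = \sum_(k <- B) 2 ^ k)%N -> A =i B.
Proof.
move=> uA uB; pose N := (\max_(k <- A ++ B) k).+1.
have lt_N (C : seq nat) : {subset C <= A ++ B} -> {in C, forall k, k < N}%N.
  by move=> CAB k /CAB kAB; rewrite /N ltnS; exact: leq_bigmax_seq.
have to_ord (C : seq nat) : uniq C -> {in C, forall k, k < N}%N ->
    (\sum_(k <- C) 2 ^ k = \sum_(k < N) ((k : nat) \in C) * 2 ^ k)%N.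
  move=> uC CN; rewrite -(big_mkord xpredT (fun k => (k \in C) * 2 ^ k)%N).
  rewrite (perm_big [seq k <- iota 0 N | k \in C]).
    rewrite big_filter big_mkcond /index_iota subn0.
    by apply: eq_bigr => k _; case: (k \in C); rewrite ?mul1n ?mul0n.
  apply: uniq_perm; rewrite ?filter_uniq ?iota_uniq// => k.
  by rewrite mem_filter mem_iota /=; case: (boolP (k \in C)) => // /CN ->.
move=> E.
have digits_eq (a b : nat -> bool) n : (\sum_(k < n) a k * 2 ^ k = \sum_(k < n) b k * 2 ^ k)%N ->
    forall k, (k < n)%N -> a k = b k.
  elim: n a b => [//|n IH] a b; rewrite !big_ord_recl /= !expn0 !muln1.
  have shift (c : nat -> bool) :
    (\sum_(i < n) c (bump 0 i) * 2 ^ bump 0 i = (\sum_(i < n) c i.+1 * 2 ^ i).*2)%N.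
    rewrite -mul2n big_distrr; apply: eq_bigr => i _.
    by rewrite /bump /= add1n expnS mulnCA.
  rewrite !shift => e [|k] kn.
    by have := congr1 odd e; rewrite !oddD !odd_double !addbF !oddb.
  apply: (IH (fun k => a k.+1) (fun k => b k.+1)) => //.
  have e0 : a 0%N = b 0%N by have := congr1 odd e; rewrite !oddD !odd_double !addbF !oddb.
  by move: e; rewrite e0 => /addnI/double_inj.
move=> k; case: (ltnP k N) => kN.
  apply: (digits_eq (fun k => k \in A) (fun k => k \in B) N) => //.
  rewrite -!to_ord//; apply: lt_N => x; rewrite mem_cat => ->; rewrite ?orbT//.
by apply/idP/idP => kC; move: kN; rewrite leqNgt (lt_N [:: k])// ?inE// => x;
   rewrite inE mem_cat => /eqP ->; rewrite kC ?orbT.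
Qed.

Definition two_part (n : nat) : nat := (2 ^ logn 2 n)%N.
(* Glaisher's map: the part 2^k * m, m odd, becomes 2^k parts equal to m.  The binary
   digits of the multiplicity of m recover the parts 2^k * m. *)
Definition glaisher (s : seq nat) : seq nat :=
  flatten [seq nseq (two_part n) (n %/ two_part n)%N | n <- s].

Lemma two_partK n : (0 < n)%N -> (n %/ two_part n * two_part n = n)%N.
Proof. by move=> n0; rewrite divnK// pfactor_dvdnn. Qed.

Lemma odd_two_part n : (0 < n)%N -> odd (n %/ two_part n)%N.
Proof.
move=> n0; have [m co E] := pfactor_coprime (isT : prime 2) n0.
by rewrite {1}E mulnK ?expn_gt0// -coprime2n.
Qed.

Lemma sumn_glaisher s : all (fun n => 0 < n)%N s -> sumn (glaisher s) = sumn s.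
Proof.
elim: s => [//|n s IH] /= /andP[n0 s0]; rewrite sumn_cat sumn_nseq IH//.
by rewrite two_partK.
Qed.

Lemma odd_glaisher s : all (fun n => 0 < n)%N s -> all odd (glaisher s).
Proof.
elim: s => [//|n s IH] /= /andP[n0 s0]; rewrite all_cat IH// andbT.
by rewrite all_nseq odd_two_part// orbT.
Qed.

Lemma count_glaisher m s : count_mem m (glaisher s) =
  (\sum_(k <- [seq logn 2 n | n <- s & (n %/ two_part n == m)%N]) 2 ^ k)%N.
Proof.
elim: s => [|n s IH]; first by rewrite /= big_nil.
rewrite /glaisher /= count_cat -/(glaisher s) IH count_nseq /=.
by case: eqP => _; rewrite ?mul1n ?mul0n ?add0n//= big_cons.
Qed.

Lemma glaisher_inj s t : uniq s -> uniq t ->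
  all (fun n => 0 < n)%N s -> all (fun n => 0 < n)%N t ->
  perm_eq (glaisher s) (glaisher t) -> s =i t.
Proof.
have half s' t' : uniq s' -> uniq t' ->
  all (fun n => 0 < n)%N s' -> all (fun n => 0 < n)%N t' ->
  perm_eq (glaisher s') (glaisher t') -> {subset s' <= t'}.
  move=> us ut s0 t0 p n ns; have n0 := allP s0 n ns.
  pose m := (n %/ two_part n)%N.
  (* The 2-adic valuations of the parts with odd part [m]: they are the binary digits of the
     multiplicity of [m], and together with [m] they determine the parts. *)
  pose S r := [seq logn 2 x | x <- r & (x %/ two_part x == m)%N].
  have uS r : uniq r -> all (fun n => 0 < n)%N r -> uniq (S r).
    move=> ur r0; rewrite map_inj_in_uniq ?filter_uniq// => x y.
    rewrite !mem_filter => /andP[/eqP xm xr] /andP[/eqP ym yr] exy.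
    rewrite -(two_partK (allP r0 x xr)) -(two_partK (allP r0 y yr)) xm ym.
    by rewrite /two_part exy.
  have E : S s' =i S t'.
    by apply: binary_sum_inj; rewrite ?uS// -!count_glaisher; exact: (permP p).
  have : logn 2 n \in S s' by apply: map_f; rewrite mem_filter eqxx.
  rewrite E => /mapP[x]; rewrite mem_filter => /andP[/eqP xm xt] e.
  suff -> : n = x by [].
  rewrite -(two_partK n0) -(two_partK (allP t0 x xt)) xm -/m.
  by rewrite /two_part e.
move=> us ut s0 t0 p x; apply/idP/idP; first exact: half.
by apply: half; rewrite // perm_sym.
Qed.

(* The g (h i), i in s, are as many as the e i, and the pairings with B exhibit an inverse
   of the square matrix expressing the former in the latter. *)
Lemma span_by_duality (V : lmodType Qbeta) (I J : eqType) (e : I -> V)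
    (g : J -> V) (B : J -> V -> Qbeta) (Q : pred J) (s : seq I) (h : I -> J) :
  uniq s -> (forall j, linear (B j : V -> Qbeta^o)) ->
  {in s, forall i, Q (h i)} ->
  {in s, forall i, in_span (mem s) e (g (h i))} ->
  {in s &, forall i j, i != j -> B (h i) (g (h j)) = 0} ->
  {in s, forall i, B (h i) (g (h i)) != 0} ->
  {in s, forall i, in_span Q g (e i)}.
Proof.
move=> us lB Qh gh Bij Bii.
pose n := size s; pose t := in_tuple s.
have ts (i : 'I_n) : tnth t i \in s by exact: mem_tnth.
have coef (j : 'I_n) : exists c : I -> Qbeta, g (h (tnth t j)) = \sum_(i < n) c (tnth t i) *: e (tnth t i).
  have [r rs [c ->]] := gh _ (ts j).
  rewrite (@sum_count _ _ r s)//; last by move=> x xr; exact: (allP rs).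
  exists (fun i => c i *+ count_mem i r).
  rewrite (big_tnth _ _ s); apply: eq_bigr => i _.
  by rewrite scalerMnl.
have [c cE] := choice coef.
pose Bm : 'M[Qbeta]_n := \matrix_(j, i) c j (tnth t i).
pose D i := B (h (tnth t i)) (g (h (tnth t i))).
pose A : 'M[Qbeta]_n := \matrix_(k, j) ((D j)^-1 * B (h (tnth t j)) (e (tnth t k))).
have BA : Bm *m A = 1%:M.
  apply/matrixP => i j; rewrite !mxE.
  have -> : \sum_k Bm i k * A k j = (D j)^-1 * B (h (tnth t j)) (g (h (tnth t i))).
    rewrite cE (lin_sum (lB _)) mulr_sumr; apply: eq_bigr => k _.
    by rewrite !mxE (linZ (lB _)) mulrCA.
  case: eqVneq => [->|ij]; first by rewrite mulVf//; exact: Bii.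
  rewrite Bij ?mulr0// eq_sym; apply: contra_neq ij.
  by move: (us) => /(@tuple_uniqP _ _ t); exact.
(* A one-sided inverse of a square matrix is two-sided; in this order the identity expresses the [e]
   through the [g]. *)
have AB := mulmx1C BA.
move=> i si; have /tnthP[k ->] : i \in t by [].
rewrite (_ : e _ = \sum_(j < n) A k j *: g (h (tnth t j))).
  by apply: in_span_sum => j _; apply/in_spanZ/in_span_gen/Qh.
under eq_bigr => j _ do rewrite cE scaler_sumr.
rewrite exchange_big /= (bigD1 k)//= [X in _ + X]big1 ?addr0.
  under eq_bigr => j _ do rewrite scalerA.
  rewrite -scaler_suml.
  have := congr1 (fun X : 'M_n => X k k) AB; rewrite !mxE eqxx.
  by under eq_bigr => j _ do rewrite [Bm _ _]mxE; move=> ->; rewrite scale1r.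
move=> l lk; under eq_bigr => j _ do rewrite scalerA.
rewrite -scaler_suml.
have := congr1 (fun X : 'M_n => X k l) AB; rewrite !mxE eq_sym (negbTE lk).
by under eq_bigr => j _ do rewrite [Bm _ _]mxE; move=> ->; rewrite scale0r.
Qed.

Definition nat_parts (s : seq int) : seq nat := [seq `|n|%N | n <- s & n != 0].

Lemma fock_word_ge0 s : fock_word s -> {in s, forall n, 0 <= n}.
Proof. by case/andP => _ /allP. Qed.

Lemma fock_word_uniq s : fock_word s -> uniq s.
Proof.
case/andP => so _; apply: sorted_uniq so; last by move=> a; rewrite ltxx.
by move=> a b c; lia.
Qed.

Lemma fock_word_inj s t : fock_word s -> fock_word t -> s =i t -> s = t.
Proof.
case/andP => ss _ /andP[st _]; apply: irr_sorted_eq ss st.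
  by move=> a b c; lia.
by move=> a; rewrite ltxx.
Qed.

Lemma nat_parts_gt0 s : all (fun n => 0 < n)%N (nat_parts s).
Proof. by apply/allP => n /mapP[k]; rewrite mem_filter => /andP[k0 _] ->; lia. Qed.

Lemma nat_parts_uniq s : fock_word s -> uniq (nat_parts s).
Proof.
move=> fs; rewrite map_inj_in_uniq ?filter_uniq ?fock_word_uniq// => a b.
rewrite !mem_filter => /andP[_ /(fock_word_ge0 fs) a0] /andP[_ /(fock_word_ge0 fs) b0].
lia.
Qed.

Lemma mem_nat_parts s (n : nat) : fock_word s ->
  (n \in nat_parts s) = (n != 0%N) && (n%:Z \in s).
Proof.
move=> fs; apply/mapP/andP => [[k]|[n0 ns]].
  rewrite mem_filter => /andP[k0 ks] ->; have k1 := fock_word_ge0 fs ks.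
  by split; [lia|rewrite (_ : `|k|%N%:Z = k)//; lia].
by exists n%:Z => //; rewrite mem_filter ns andbT; lia.
Qed.

Lemma sumn_nat_parts s : fock_word s -> (sumn (nat_parts s))%:Z = \sum_(a <- s) a.
Proof.
case/andP => _; elim: s => [|a s IH] /=; first by rewrite big_nil.
case/andP => a0 s0; rewrite big_cons -IH// /nat_parts /=.
by case: eqP => [->|_] /=; [rewrite add0r|lia].
Qed.

Lemma size_nat_parts s : fock_word s -> size s = ((0%:Z \in s) + size (nat_parts s))%N.
Proof.
move=> fs; rewrite size_map size_filter -(count_predC (pred1 0) s).
by rewrite -[count (pred1 _) s]/(count_mem _ s) count_uniq_mem ?fock_word_uniq.
Qed.

Definition odd_parts (s : seq int) : seq nat := sort geq (glaisher (nat_parts s)).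

Lemma odd_partsP (d : nat) e s : graded_word d%:Z e s ->
  odd_part (odd_parts s) /\ sumn (odd_parts s) = d.
Proof.
case/and3P => fs /eqP ds _; rewrite /odd_part /odd_parts sort_sorted; last first.
  by move=> a b; rewrite /geq /=; lia.
rewrite all_sort odd_glaisher ?nat_parts_gt0//; split => //.
rewrite -(perm_sumn (s1 := glaisher (nat_parts s))); last by rewrite perm_sym perm_sort.
rewrite sumn_glaisher ?nat_parts_gt0//.
by have := sumn_nat_parts fs; rewrite ds; lia.
Qed.

(** Glaisher's map recovers the nonzero letters only. The common parity [e] of the lengths then
    decides whether the letter 0 occurs. *)
Lemma odd_parts_inj (d1 d2 : int) e s t : graded_word d1 e s -> graded_word d2 e t ->
  perm_eq (odd_parts s) (odd_parts t) -> s = t.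
Proof.
move=> /and3P[fs _ /eqP es] /and3P[ft _ /eqP et].
rewrite perm_sort (permPr (permEl (perm_sort _ _))) => p.
have E : nat_parts s =i nat_parts t.
  by apply: glaisher_inj p; rewrite ?nat_parts_uniq ?nat_parts_gt0.
have zero : (0%:Z \in s) = (0%:Z \in t).
  have szE : size (nat_parts s) = size (nat_parts t).
    by apply/perm_size/uniq_perm; rewrite ?nat_parts_uniq.
  move: es; rewrite -et !size_nat_parts// szE !oddD.
  by move/addIb; rewrite !oddb.
apply: fock_word_inj => // n.
case: (ltP n 0) => n0.
  by apply/idP/idP => [/(fock_word_ge0 fs)|/(fock_word_ge0 ft)]; lia.
have -> : n = `|n|%N%:Z by lia.
move: `|n|%N => k; case: (eqVneq k 0%N) => [->//|k0].
by have := E k; rewrite !mem_nat_parts// k0.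
Qed.

(** Letters are nonnegative with sum [d], hence at most [d]; a strictly decreasing word is therefore
    a mask of the list d, ..., 1, 0. *)
Lemma graded_word_enum (d : nat) e :
  exists2 L : seq (seq int), uniq L & forall s, (s \in L) = graded_word d%:Z e s.
Proof.
pose base := rev [seq k%:Z | k <- iota 0 d.+1].
have sb : sorted (fun a b : int => b < a) base.
  rewrite rev_sorted sorted_map; apply: sub_sorted (iota_ltn_sorted 0 d.+1).
  by move=> a b; lia.
exists (undup [seq s <- [seq mask m base | m : (size base).-tuple bool] | graded_word d%:Z e s]).
  exact: undup_uniq.
move=> s; rewrite mem_undup mem_filter; case gs : (graded_word _ _ _) => //=.
have /and3P[fs /eqP ds _] := gs.
apply/mapP; pose m := map (mem s) base.
have sm : size m == size base by rewrite size_map.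
exists (Tuple sm); first by rewrite mem_enum.
rewrite /= -filter_mask; apply: (@irr_sorted_eq _ (fun a b : int => b < a)).
- by move=> a b c; lia.
- by move=> a; rewrite /= ltxx.
- by case/andP: fs.
- by apply: sorted_filter sb => a b c; lia.
move=> n; rewrite mem_filter /=; case: (boolP (n \in s)) => //= ns.
suff -> : n \in base by [].
rewrite mem_rev; apply/mapP; exists `|n|%N; have n0 := fock_word_ge0 fs ns; last by lia.
rewrite mem_iota /= add0n ltnS; move: ds; rewrite (big_rem n)//=.
have h : 0 <= \sum_(y <- rem n s) y.
  by rewrite big_seq; apply: sumr_ge0 => a /mem_rem/(fock_word_ge0 fs).
by move: h; move: (\sum_(y <- rem n s) _) => S h; lia.
Qed.

Section EvenSpan.
Variable M : neutral_fermions.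

Lemma odd_part_perm la mu : odd_part la -> odd_part mu -> perm_eq la mu -> la = mu.
Proof.
case/andP => sl _ /andP[sm _]; apply: sorted_eq sl sm.
  by move=> a b c; rewrite /geq /=; lia.
by move=> a b; rewrite /geq /=; lia.
Qed.

Lemma even_word_span (d : nat) s : graded_word d%:Z false s ->
  in_span odd_part (bword M) (word M s).
Proof.
have [L uL LE] := graded_word_enum d false; rewrite -LE.
apply: (@span_by_duality _ _ _ (word M) (bword M) 
  (fun mu => bracket_form (bword M mu)) odd_part L odd_parts) => //.
- by move=> mu; exact: bracket_form_linearr.
- by move=> t; rewrite LE => /odd_partsP[].
- move=> t; rewrite LE => gt; have [/andP[_ ot] dE] := odd_partsP gt.
  by apply: in_span_sub (graded_bword M ot) => r; rewrite dE -LE.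
- move=> t r; rewrite !LE => gt gr tr.
  have [/andP[_ ot] _] := odd_partsP gt; have [/andP[_ or] _] := odd_partsP gr.
  rewrite bracket_form_bword//; case: (boolP (perm_eq _ _)) => [p|]; last by rewrite mulr0.
  by move: tr; rewrite (odd_parts_inj gt gr p) eqxx.
move=> t; rewrite LE => gt; have [/andP[_ ot] _] := odd_partsP gt.
rewrite bracket_form_bword// perm_refl mulr1 mulf_neq0 ?invr_neq0 ?expf_neq0//.
  by rewrite (@Qbeta_natr_neq0 2).
exact/Qbeta_natr_neq0/zee_gt0.
Qed.

Lemma parity_span v : in_span (parity_word false) (word M) v ->
  in_span odd_part (bword M) v.
Proof.
apply: (in_span_map (f := id)) => // s /andP[fs es].
apply: (@even_word_span (sumn (nat_parts s))); rewrite /graded_word fs es andbT.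
by rewrite sumn_nat_parts ?eqxx.
Qed.

End EvenSpan.

(** * Power series and exponentials *)

Implicit Types (m a b : monomial).

Definition msub m a : monomial := [fsfun i in finsupp m => (m i - a i)%N].

Lemma msubE m a i : msub m a i = (m i - a i)%N.
Proof. by rewrite fsfunE; case: finsuppP => // _; rewrite sub0n. Qed.

Lemma monomial_le_finite m : exists2 L : seq monomial, uniq L &
  forall a, (a \in L) <-> (forall i, a i <= m i)%N.
Proof.
pose K := (\max_(i <- finsupp m) m i).+1.
pose G (g : {ffun finsupp m -> 'I_K}) : monomial :=
  [fsfun i : finsupp m => (g i : nat)].
pose L : seq monomial := undup [seq G g | g <- enum {ffun finsupp m -> 'I_K}].
exists (filter (fun a : monomial => `[< forall i, (a i <= m i)%N >]) L).
  by rewrite filter_uniq// undup_uniq.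
move=> a; rewrite mem_filter mem_undup; split => [/andP[/asboolP //]|am].
apply/andP; split; first exact/asboolP.
have mK i : (m i < K)%N.
  rewrite /K ltnS; have [im|im] := boolP (i \in finsupp m).
    exact: leq_bigmax_seq.
  by rewrite fsfun_dflt.
apply/mapP; exists [ffun i : finsupp m => Ordinal (leq_ltn_trans (am (val i)) (mK (val i)))].
  by rewrite mem_enum.
apply/fsfunP => i; have [im|im] := boolP (i \in finsupp m).
  by rewrite fsfun_ffun insubT /= ffunE.
by have := am i; rewrite fsfun_ffun insubF ?(negbTE im)// (fsfun_dflt im) leqn0 => /eqP.
Qed.

Definition divs m : seq monomial := s2val (cid2 (monomial_le_finite m)).

Lemma divs_uniq m : uniq (divs m).
Proof. by rewrite /divs; case: cid2. Qed.

Lemma mem_divs m a : reflect (forall i, a i <= m i)%N (a \in divs m).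
Proof. by rewrite /divs; case: cid2 => /= L _ h; apply: (iffP idP) => /h. Qed.

Lemma msub_divs m a b : b \in divs (msub m a) -> b \in divs m.
Proof.
move/mem_divs => h; apply/mem_divs => i; apply: leq_trans (h i) _.
by rewrite msubE leq_subr.
Qed.

Lemma divs_msubC m a b : a \in divs m -> b \in divs m ->
  (b \in divs (msub m a)) = (a \in divs (msub m b)).
Proof.
move=> /mem_divs am /mem_divs bm.
by apply/mem_divs/mem_divs => h i; have := h i; have := am i; have := bm i; rewrite !msubE; lia.
Qed.

Lemma msub_msubC m a b : msub (msub m a) b = msub (msub m b) a.
Proof. by apply/fsfunP => i; rewrite !msubE; lia. Qed.

(** Both sides run over the pairs whose product divides [m], a symmetric condition. *)
Lemma sum_divs_exchange (V : nmodType) m (F : monomial -> monomial -> V) :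
  \sum_(a <- divs m) \sum_(b <- divs (msub m a)) F a b =
  \sum_(b <- divs m) \sum_(a <- divs (msub m b)) F a b.
Proof.
have restrict a (G : monomial -> V) : \sum_(b <- divs (msub m a)) G b =
    \sum_(b <- divs m | b \in divs (msub m a)) G b.
  rewrite -[RHS]big_filter; apply: perm_big; apply: uniq_perm.
  - exact: divs_uniq.
  - by rewrite filter_uniq// divs_uniq.
  move=> b; rewrite mem_filter; case: (boolP (b \in _)) => //= /msub_divs ->.
  by [].
under eq_bigr => a _ do rewrite restrict.
under [RHS]eq_bigr => a _ do rewrite restrict.
rewrite big_seq [RHS]big_seq.
rewrite (exchange_big_dep (fun b => b \in divs m)) /=; last first.
  by move=> a b _ /msub_divs.
apply: eq_bigr => b bm; rewrite big_seq_cond [RHS]big_seq_cond; apply: eq_bigl => a.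
by case am : (a \in divs m) => //=; rewrite divs_msubC.
Qed.

Lemma convE (U V : Type) (Z : lmodType Qbeta) (op : U -> V -> Z)
    (f : series U) (g : series V) m :
  conv op f g m = \sum_(a <- divs m) op (f a) (g (msub m a)).
Proof.
rewrite /conv (@fsum_seq _ _ _ [seq (a, msub m a) | a <- divs m]).
- rewrite big_map big_seq_cond [RHS]big_seq; apply: eq_bigl => a.
  case am : (a \in divs m) => //=; apply/asboolP => i /=.
  by move/mem_divs: am => /(_ i) am; rewrite msubE; lia.
- by rewrite map_inj_in_uniq ?divs_uniq// => a b _ _ [].
move=> [a b] /asboolP /= abm /negP; case; apply/mapP; exists a.
  by apply/mem_divs => i; rewrite -(abm i) leq_addr.
by congr pair; apply/fsfunP => i; rewrite msubE -(abm i) addKn.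
Qed.

Lemma mon1_divs m : mon1 \in divs m.
Proof. by apply/mem_divs => i; rewrite fsfunE. Qed.

Lemma msub1 m : msub m mon1 = m.
Proof. by apply/fsfunP => i; rewrite msubE fsfunE subn0. Qed.

(** The monomial [m] divides itself but not a proper quotient. The number of divisors thus serves as
    the measure that bounds powers of series without constant term. *)
Lemma size_divs_msub m a : a \in divs m -> a != mon1 ->
  (size (divs (msub m a)) < size (divs m))%N.
Proof.
move=> /mem_divs am a1; apply: (@uniq_leq_size _ (m :: divs (msub m a))) => [/=|b].
  rewrite divs_uniq andbT; apply: contra a1 => /mem_divs h; apply/eqP/fsfunP => i.
  by have := h i; have := am i; rewrite msubE fsfunE; lia.
by rewrite inE => /predU1P[->|/msub_divs//]; apply/mem_divs.
Qed.

Section Boson.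
Variables (M : neutral_fermions) (H : series (fock M -> fock M)).
Hypotheses (H_linear : forall m, linear (H m)) (H_mon1 : forall v, H mon1 v = 0).

Definition hpow j v : series (fock M) := iter j (op_app H) (scst v).
Arguments hpow : simpl never.

Lemma hpowS j v m :
  hpow j.+1 v m = \sum_(a <- divs m) H a (hpow j v (msub m a)).
Proof. by rewrite /hpow /= /op_app convE. Qed.

Lemma hpow_linear j m : linear (fun v => hpow j v m).
Proof.
elim: j m => [|j IH] m c u v.
  by rewrite /hpow /= /scst; case: eqP => // _; rewrite scaler0 addr0.
rewrite !hpowS scaler_sumr -big_split; apply: eq_bigr => a _ /=.
by rewrite IH H_linear.
Qed.

(** Since [H mon1] vanishes, every further factor of H takes a nontrivial divisor out of [m], so at
    each monomial the exponential is a finite sum. *)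
Lemma hpow_large j v m : (size (divs m) <= j)%N -> hpow j v m = 0.
Proof.
elim: j m => [|j IH] m mj.
  by have := mon1_divs m; case: (divs m) mj.
rewrite hpowS big_seq big1// => a am; case: (eqVneq a mon1) => [->|a1].
  by rewrite H_mon1.
rewrite IH ?(lin0 (H_linear _))// -ltnS; apply: leq_trans mj.
exact: size_divs_msub.
Qed.

Lemma bosonE v m J : (size (divs m) <= J)%N -> boson H v m =
  \sum_(j < J) (j`!%:R)^-1 * pairing (covac M) (hpow j v m).
Proof.
move=> mJ; rewrite /boson /exp_app (@fsum_seq _ _ _ (iota 0 J)) ?iota_uniq//; last first.
  by move=> j _; rewrite mem_iota /= => jJ; rewrite [iter _ _ _ _]hpow_large ?scaler0//; lia.
rewrite (lin_sum (covac_lin (M := M))) -[iota 0 J]/(iota 0 J).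
rewrite -(big_mkord xpredT (fun j => (j`!%:R)^-1 * pairing (covac M) (hpow j v m))).
rewrite /index_iota subn0; apply: eq_big => [j|j _]; first by rewrite in_setT.
exact: (linZ (covac_lin (M := M))).
Qed.

Lemma boson_linear m : linear (fun v => boson H v m : Qbeta^o).
Proof.
move=> c u v; rewrite !(bosonE _ (leqnn _)) scaler_sumr -big_split.
apply: eq_bigr => j _ /=; rewrite hpow_linear (covac_lin (M := M)).
by rewrite mulrDr; congr (_ + _); exact: mulrCA.
Qed.

Lemma boson_vac : (forall m, H m (vac M) = 0) -> boson H (vac M) = sone.
Proof.
move=> Hvac; apply/funext => m; rewrite (bosonE _ (leqnSn _)) big_ord_recl big1 ?addr0.
  rewrite fact0 invr1 mul1r /hpow /= /sone /scst; case: eqP => _; first exact: pairing_vac.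
  exact: (lin0 (covac_lin (M := M))).
move=> j _; rewrite lift0.
have h0 k n : hpow k.+1 (vac M) n = 0.
  elim: k n => [|k IH] n; rewrite hpowS big1// => a _.
    by rewrite /hpow /= /scst; case: eqP => _; rewrite ?Hvac// (lin0 (H_linear _)).
  by rewrite IH (lin0 (H_linear _)).
by rewrite h0 (lin0 (covac_lin (M := M))) mulr0.
Qed.

Lemma boson_parity v :
  (forall m u, in_span (parity_word true) (word M) u ->
               in_span (parity_word true) (word M) (H m u)) ->
  in_span (parity_word true) (word M) v -> boson H v = 0.
Proof.
move=> Hpar pv; apply/funext => m; rewrite (bosonE _ (leqnn _)) big1// => j _.
rewrite covac_parity ?mulr0//.
move: (nat_of_ord j) => {j} j; elim: j m => [|j IH] m.
  by rewrite /hpow /= /scst; case: eqP => // _; exact: in_span0.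
by rewrite hpowS; apply: in_span_sum => a _; apply: Hpar.
Qed.

Variables (c : fock M -> fock M) (p : pseries).
Hypotheses (c_linear : linear c) (covac_c : forall v, pairing (covac M) (c v) = 0)
  (H_c : forall m v, H m (c v) = c (H m v) + p m *: v).

(** Leibniz rule for a scalar commutator: [H, c] = p gives [H^j, c] = j p H^(j-1). At [j = 0] the
    truncated [j.-1] is harmless because of the factor [j]. *)
Lemma hpow_bracket j v m : hpow j (c v) m = c (hpow j v m) +
  j%:R *: \sum_(a <- divs m) p a *: hpow j.-1 v (msub m a).
Proof.
elim: j m => [|j IH] m.
  by rewrite scale0r addr0 /hpow /= /scst; case: eqP => // _; rewrite (lin0 c_linear).
have step a : H a (hpow j (c v) (msub m a)) = c (H a (hpow j v (msub m a))) +
    (p a *: hpow j v (msub m a) +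
     j%:R *: \sum_(b <- divs (msub m a)) p b *: H a (hpow j.-1 v (msub (msub m a) b))).
  rewrite IH (linD (H_linear a)) H_c -addrA; congr (_ + (_ + _)).
  rewrite (linZ (H_linear a)) (lin_sum (H_linear a)); congr (_ *: _).
  by apply: eq_bigr => b _; rewrite (linZ (H_linear a)).
rewrite hpowS (eq_bigr _ (fun a _ => step a)) !big_split /=; congr (_ + _).
  by rewrite hpowS (lin_sum c_linear).
rewrite -scaler_sumr sum_divs_exchange -addn1 natrD scalerDl scale1r addrC; congr (_ + _).
case: j {IH step} => [|j]; first by rewrite !scale0r.
congr (_ *: _); apply: eq_bigr => b _; rewrite /= hpowS scaler_sumr.
by apply: eq_bigr => a _; rewrite msub_msubC.
Qed.

Lemma boson_creation v : boson H (c v) = smul p (boson H v).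
Proof.
apply/funext => m; rewrite /smul convE.
(* One term more than necessary: the term [j = 0] dies since <0| c = 0, and lowering the exponent by
   one leaves [size (divs m)] terms, enough for every quotient of [m]. *)
rewrite (@bosonE _ _ (size (divs m)).+1)// big_ord_recl.
rewrite hpow_bracket scale0r addr0 covac_c mulr0 add0r.
rewrite [RHS]big_seq (eq_bigr (fun a => \sum_(j < size (divs m))
    p a * ((j`!%:R)^-1 * pairing (covac M) (hpow j v (msub m a))))); last first.
  move=> a am; rewrite (@bosonE _ _ (size (divs m))) ?mulr_sumr//.
  have [->|a1] := eqVneq a mon1; first by rewrite msub1.
  by apply: ltnW; exact: size_divs_msub.
rewrite -big_seq exchange_big /=; apply: eq_bigr => j _.
rewrite /bump add1n hpow_bracket (linD (covac_lin (M := M))) covac_c add0r.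
rewrite (linZ (covac_lin (M := M))) (lin_sum (covac_lin (M := M))) /=.
rewrite scaler_sumr mulr_sumr; apply: eq_bigr => a _.
have fact_succ : (j.+1`!%:R)^-1 * j.+1%:R = (j`!%:R)^-1 :> Qbeta.
  by rewrite factS natrM invfM mulrC mulVKf// Qbeta_natr_neq0.
rewrite (linZ (covac_lin (M := M))) [LHS]mulrA fact_succ.
exact: mulrCA.
Qed.

End Boson.

(** * The deformed power sums *)

Lemma series_scaleE (c : Qbeta) (f : pseries) m : (c *: f) m = c * f m.
Proof. by []. Qed.

Lemma series_addE (f g : pseries) m : (f + g) m = f m + g m.
Proof. by []. Qed.

Lemma series_subE (f g : pseries) m : (f - g) m = f m - g m.
Proof. by []. Qed.

(* The one-variable series [\sum_n al n x_i^n]: the monomial m is a power of x_i exactly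
   when it is [xpow i (m i)]. *)
Definition uni (i : nat) (al : nat -> Qbeta) : pseries :=
  fun m => if m == xpow i (m i) then al (m i) else 0.

Lemma xpowE i n j : xpow i n j = if j == i then n else 0%N.
Proof. by rewrite /xpow fsfun_withE; case: eqP => // _; rewrite fsfunE. Qed.

Lemma uni_xpow i al n : uni i al (xpow i n) = al n.
Proof. by rewrite /uni !xpowE !eqxx. Qed.

Lemma eq_uni i al be : al =1 be -> uni i al = uni i be.
Proof. by move=> E; apply/funext => m; rewrite /uni E. Qed.

Lemma uni_smul i al be : smul (uni i al) (uni i be) =
  uni i (fun n => \sum_(k < n.+1) al k * be (n - k)%N).
Proof.
apply/funext => m; rewrite /smul convE {3}/uni.
case: eqP => [E|ne].
  rewrite E xpowE eqxx; move: (m i) => n {E m}.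
  rewrite (perm_big [seq xpow i k | k <- iota 0 n.+1]); last first.
    apply: uniq_perm; first exact: divs_uniq.
      rewrite map_inj_uniq ?iota_uniq// => k l /(congr1 (fun a : monomial => a i)).
      by rewrite !xpowE eqxx.
    move=> a; apply/mem_divs/mapP => [h|[k kn ->] j].
      exists (a i); first by have := h i; rewrite mem_iota xpowE eqxx; lia.
      apply/fsfunP => j; have := h j; rewrite !xpowE; case: eqP => [->//|_].
      by lia.
    by move: kn; rewrite mem_iota !xpowE; case: eqP => // _; lia.
  rewrite big_map -(big_mkord xpredT (fun k => al k * be (n - k)%N)) /index_iota subn0.
  apply: eq_bigr => k _; rewrite uni_xpow (_ : msub _ _ = xpow i (n - k)) ?uni_xpow//.
  by apply/fsfunP => j; rewrite msubE !xpowE; case: eqP.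
rewrite big_seq big1// => a /mem_divs am; rewrite /uni.
case: eqP => [aE|_]; last by rewrite mul0r.
case: eqP => [mE|_]; last by rewrite mulr0.
case: ne; apply/fsfunP => j; have := am j; have := congr1 (fun a : monomial => a j) mE.
have := congr1 (fun a : monomial => a j) aE; rewrite !xpowE !msubE.
by case: eqP => [->//|_]; lia.
Qed.

Lemma sone_uni i : sone = uni i (fun n => (n == 0%N)%:R).
Proof.
apply/funext => m; rewrite /sone /scst /uni; case: eqP => [->|ne].
  by rewrite !fsfunE ifT ?eqxx//; apply/eqP/fsfunP => j; rewrite xpowE fsfunE; case: eqP.
case: eqP => // E; case: eqP => // m0; case: ne; rewrite E m0.
by apply/fsfunP => j; rewrite xpowE fsfunE; case: eqP.
Qed.

Lemma svar_uni i n : svar i n = uni i (fun k => (k == n)%:R).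
Proof.
apply/funext => m; rewrite /svar /uni; case: (m =P xpow i (m i)) => [E|ne].
  congr (nat_of_bool _)%:R; apply/eqP/eqP => [->|<-//]; by rewrite xpowE eqxx.
by case: eqP => // E; case: ne; rewrite {1}E; congr xpow; rewrite E xpowE eqxx.
Qed.

(** A positive power determines its variable, so one summand survives; at [n = 0] all variables
    would contribute to the constant monomial. *)
Lemma ssum_uni_xpow al i n : (0 < n)%N -> ssum (fun i => uni i al) (xpow i n) = al n.
Proof.
move=> n0; rewrite /ssum (@fsum_seq _ _ _ [:: i])//; last first.
  move=> j _; rewrite inE => ji; rewrite /uni xpowE (negbTE ji); case: eqP => // E.
  have := congr1 (fun a : monomial => a i) E; rewrite !xpowE eqxx eq_sym (negbTE ji).
  by lia.
by rewrite big_cons big_nil in_setT addr0 uni_xpow.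
Qed.

Lemma ssum_uni0 al m : al 0%N = 0 -> (forall i n, (0 < n)%N -> m <> xpow i n) ->
  ssum (fun i => uni i al) m = 0.
Proof.
move=> al0 ne; rewrite /ssum fsbig1// => i _; rewrite /uni; case: eqP => // E.
by case: (posnP (m i)) => [->//|/(ne i)]; rewrite -E.
Qed.

Definition xdeform_coef (n : nat) : Qbeta :=
  if n is n'.+1 then (- (beta / 2)) ^+ n' else 0.

Lemma xdeform_uni i : xdeform i = uni i xdeform_coef.
Proof.
apply/funext => m; rewrite /xdeform /ssum.
under eq_fsbigr do rewrite svar_uni.
rewrite (@fsum_seq _ _ _ [:: (m i).-1])//; last first.
  move=> j _; rewrite inE => ji; rewrite series_scaleE /uni; case: eqP => _; last by rewrite mulr0.
  by case: eqP => [E|_]; [move: ji; rewrite E eqxx|rewrite mulr0].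
rewrite big_cons big_nil in_setT addr0 series_scaleE /uni.
case: eqP => _; last by rewrite mulr0.
by case: (m i) => [|n]; rewrite /= ?mulr0 ?eqxx ?mulr1.
Qed.

(* Coefficient of t^n in (t / (1 + (beta/2) t))^(k+1). *)
Definition deformed_power_coef (k n : nat) : Qbeta :=
  if n is n'.+1 then (- (beta / 2)) ^+ (n' - k) * 'C(n', k)%:R else 0.

Lemma sum_bin k n : (\sum_(t < n) 'C(t, k) = 'C(n, k.+1))%N.
Proof.
elim: n => [|n IH]; first by rewrite big_ord0.
by rewrite big_ord_recr /= IH binS.
Qed.

(** Multiplication by one more factor is convolution with a geometric series: the powers of -beta/2
    collect, and the binomials add up by the hockey-stick identity [sum_bin]. *)
Lemma sexp_xdeform i k : sexp (xdeform i) k.+1 = uni i (deformed_power_coef k).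
Proof.
elim: k => [|k IH]; rewrite /sexp iterS.
  rewrite /= (sone_uni i) xdeform_uni uni_smul; apply: eq_uni => n.
  rewrite big_ord_recr /= subnn mulr1 big1 ?add0r; last first.
    by move=> j _; rewrite subn_eq0 leqNgt ltn_ord mulr0.
  by case: n => [//|n]; rewrite /= subn0 bin0 mulr1.
rewrite -/(sexp (xdeform i) k.+1) IH xdeform_uni uni_smul; apply: eq_uni => n.
rewrite big_ord_recl /= mul0r add0r; case: n => [|n]; first by rewrite big_ord0.
rewrite big_ord_recr /= /bump /= add1n subnn mulr0 addr0 -sum_bin natr_sum mulr_sumr.
rewrite -(big_mkord xpredT (fun t => (- (beta / 2)) ^+ (n - k.+1) * 'C(t, k)%:R)).
rewrite big_nat_rev /= big_mkord; apply: eq_bigr => j _.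
rewrite add0n add1n subSS (_ : (n - j = (n - j.+1).+1)%N); last by have := ltn_ord j; lia.
(* The exponents add up only if no subtraction is truncated; in the remaining case the binomial is
   0. *)
rewrite /= mulrA -exprD; have [jk|jk] := leqP k (n - j.+1).
  by congr (_ ^+ _ * _); have := ltn_ord j; lia.
by rewrite bin_small// !mulr0.
Qed.

(* Coefficient of t^n in (t + beta/2)^k, where the binomial vanishes if the exponent is
   truncated. *)
Definition shifted_power_coef (k n : nat) : Qbeta := (beta / 2) ^+ (k - n) * 'C(k, n)%:R.

Lemma sexp_shift i k : sexp (svar i 1 + (beta / 2) *: sone) k = uni i (shifted_power_coef k).
Proof.
elim: k => [|k IH].
  rewrite /sexp /= (sone_uni i); apply: eq_uni => n.
  by rewrite /shifted_power_coef sub0n expr0 mul1r bin0n.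
have E : svar i 1 + (beta / 2) *: sone = uni i (fun n => (n == 1%N)%:R + beta / 2 * (n == 0%N)%:R).
  apply/funext => m; rewrite svar_uni (sone_uni i) series_addE series_scaleE /uni.
  by case: eqP => // _; rewrite mulr0 addr0.
rewrite /sexp iterS -/(sexp _ k) IH E uni_smul; apply: eq_uni => n.
rewrite big_ord_recl /= add0r mulr1 subn0 /shifted_power_coef.
case: n => [|n].
  by rewrite big_ord0 addr0 !subn0 mulrA -exprS !bin0.
rewrite big_ord_recl big1 ?addr0; last first.
  by move=> j _; rewrite /= mulr0 addr0 mul0r.
rewrite /= mulr0 addr0 mul1r !subSS ?subn0 binS natrD mulrDr; congr (_ + _).
have [nk|nk] := ltnP n k; last by rewrite bin_small// !mulr0.
by rewrite mulrA -exprS; congr (_ ^+ _ * _); lia.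
Qed.

Lemma psum_xpow n i N : (0 < n)%N -> (0 < N)%N -> psum n (xpow i N) = (N == n)%:R.
Proof.
move=> n0 N0; rewrite /psum; under eq_fun do rewrite svar_uni.
by rewrite (ssum_uni_xpow (fun k => (k == n)%:R)).
Qed.

Lemma psum0 n m : (0 < n)%N -> (forall i N, (0 < N)%N -> m <> xpow i N) -> psum n m = 0.
Proof.
move=> n0 ne; rewrite /psum; under eq_fun do rewrite svar_uni.
by rewrite (@ssum_uni0 (fun k => (k == n)%:R))//; case: n n0.
Qed.

Lemma psum_betaE k : psum_beta k.+1 = ssum (fun i => uni i (deformed_power_coef k)).
Proof. by congr ssum; apply/funext => i; rewrite sexp_xdeform. Qed.

(** Subtracting (beta/2)^k removes exactly the constant term in each variable, without which the sum
    over infinitely many variables would not make sense. *)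
Lemma psum_braE k : psum_bra k =
  ssum (fun i => uni i (fun n => if n == 0%N then 0 else shifted_power_coef k n)).
Proof.
congr ssum; apply/funext => i; apply/funext => m.
rewrite series_subE series_scaleE sexp_shift (sone_uni i) /uni.
case: eqP => _; last by rewrite mulr0 subr0.
case: eqP => [->|_]; last by rewrite mulr0 subr0.
by rewrite /shifted_power_coef subn0 bin0 subrr.
Qed.

Lemma half_double (x : Qbeta) : (x + x) / 2 = x.
Proof. by rewrite -mulr2n -[x *+ 2]mulr_natr mulfK// (@Qbeta_natr_neq0 2). Qed.

Lemma gen_binomE (n j : nat) : (j <= n)%N -> gen_binom n%:Z j = 'C(n, j)%:R.
Proof.
move=> jn; rewrite /gen_binom.
have -> : \prod_(i < j) ((n%:Z)%:~R - i%:R) = (n ^_ j)%:R :> Qbeta.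
  rewrite ffact_prod natr_prod; apply: eq_bigr => i _.
  by rewrite natrB//; have := ltn_ord i; lia.
by rewrite -bin_ffact natrM mulfK// Qbeta_natr_neq0// fact_gt0.
Qed.

Lemma gen_binomN (n j : nat) : (0 < n)%N ->
  gen_binom (- n%:Z) j = (-1) ^+ j * 'C(n + j - 1, j)%:R.
Proof.
move=> n0; rewrite /gen_binom.
have -> : \prod_(i < j) ((- n%:Z)%:~R - i%:R) = (-1) ^+ j * ((n + j - 1) ^_ j)%:R :> Qbeta.
  rewrite ffact_prod natr_prod -[j in (-1) ^+ j]card_ord -prodrN.
  rewrite (reindex_inj rev_ord_inj) /=; apply: eq_bigr => i _.
  rewrite mulrNz -opprD -natrD; congr (- _%:R).
  by have := ltn_ord i; lia.
by rewrite -bin_ffact natrM mulrA mulfK// Qbeta_natr_neq0// fact_gt0.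
Qed.

Lemma sign_odd_sub (n k : nat) : odd k -> (n <= k)%N ->
  (-1) ^+ n = - (-1) ^+ (k - n) :> Qbeta.
Proof.
by move=> ok nk; rewrite -signr_odd -[in RHS]signr_odd oddB// ok; case: odd => /=;
   rewrite ?opprK.
Qed.

(** For odd [k] the signs (-1)^n and (-1)^(n-k) are opposite, so both halves of [bcoef] agree and
    their average is either one. The same cancellation governs negative indices. *)
Lemma bcoef_pos (n k : nat) : odd k ->
  bcoef n%:Z k%:Z = (- (beta / 2)) ^+ (n - k) * 'C(n, k)%:R.
Proof.
move=> ok; rewrite /bcoef /shift_coef; case: ifP => kn; last first.
  by rewrite mulr0 subr0 mul0r bin_small ?mulr0//; lia.
have kn' : (k <= n)%N by lia.
have -> : `|n%:Z - k%:Z|%N = (n - k)%N by lia.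
rewrite gen_binomE ?leq_subr// bin_sub// -exprnP.
have -> : (-1) ^+ n = - (-1) ^+ (n - k) :> Qbeta.
  by rewrite -signr_odd -[in RHS]signr_odd oddB// ok addbT; case: odd => /=; rewrite ?opprK.
rewrite mulNr opprK mulrCA -exprNn half_double.
exact: mulrC.
Qed.

Lemma bcoef_neg (n k : nat) : (0 < n)%N -> odd k ->
  bcoef (- n%:Z) (- k%:Z) = (beta / 2) ^+ (k - n) * 'C(k.-1, n.-1)%:R.
Proof.
move=> n0 ok; rewrite /bcoef /shift_coef; case: ifP => kn; last first.
  by rewrite mulr0 subr0 mul0r bin_small ?mulr0//; lia.
have kn' : (n <= k)%N by lia.
have -> : `|- n%:Z - - k%:Z|%N = (k - n)%N by lia.
rewrite gen_binomN// (_ : (n + (k - n) - 1)%N = k.-1); last by lia.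
rewrite sgnzN -exprnP (sign_odd_sub ok kn').
have -> : 'C(k.-1, k - n) = 'C(k.-1, n.-1).
  by rewrite -bin_sub; [congr 'C(_, _)|]; lia.
rewrite mulNr opprK [(- (beta / 2)) ^+ _]exprNn.
have ss : (-1) ^+ (k - n) * (-1) ^+ (k - n) = 1 :> Qbeta by rewrite -expr2 sqrr_sign.
by rewrite mulrACA !mulrA ss !mul1r half_double mulrC.
Qed.

Lemma natr_ratio_cancel (K : fieldType) (P : K) (n k c d : nat) :
  (2 : K) != 0 -> (n%:R : K) != 0 -> (n * d = k * c)%N ->
  2 / n%:R * (P * c%:R * (k%:R / 2)) = P * d%:R.
Proof.
move=> h2 hn /(congr1 (fun x => x%:R : K)); rewrite !natrM => e.
have -> : d%:R = k%:R * c%:R / n%:R :> K by rewrite -e mulrC mulKf.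
by field; rewrite hn h2.
Qed.

(** The factor 2/n comes from H, and k/2 from the commutator of b_k with b_(-k). The denominator
    disappears by k C(n, k) = n C(n-1, k-1). *)
Lemma bcoef_pos_bracket (n k : nat) : odd k -> (0 < n)%N ->
  2 / n%:R * (bcoef n%:Z k%:Z * (k%:R / 2)) = deformed_power_coef k.-1 n.
Proof.
case: k n => [//|k] [//|n] ok _; rewrite bcoef_pos// subSS.
apply: natr_ratio_cancel; [exact: Qbeta_natr_neq0|exact: Qbeta_natr_neq0|].
by rewrite -mul_bin_diag.
Qed.

(** The absorption identity now runs the other way: k C(k-1, n-1) = n C(k, n). *)
Lemma bcoef_neg_bracket (n k : nat) : odd k -> (0 < n)%N ->
  2 / n%:R * (bcoef (- n%:Z) (- k%:Z) * (k%:R / 2)) = shifted_power_coef k n.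
Proof.
case: k n => [//|k] [//|n] ok _; rewrite bcoef_neg//.
apply: natr_ratio_cancel; [exact: Qbeta_natr_neq0|exact: Qbeta_natr_neq0|].
by rewrite -mul_bin_diag.
Qed.

Lemma psum_beta_xpow k i N : odd k -> (0 < N)%N ->
  psum_beta k (xpow i N) = 2 / N%:R * (bcoef N%:Z k%:Z * (k%:R / 2)).
Proof.
by case: k => [//|k] ok N0; rewrite psum_betaE ssum_uni_xpow// bcoef_pos_bracket.
Qed.

Lemma psum_beta0 k m : odd k -> (forall i N, (0 < N)%N -> m <> xpow i N) ->
  psum_beta k m = 0.
Proof. by case: k => [//|k] _ ne; rewrite psum_betaE ssum_uni0. Qed.

Lemma psum_bra_xpow k i N : odd k -> (0 < N)%N ->
  psum_bra k (xpow i N) = 2 / N%:R * (bcoef (- N%:Z) (- k%:Z) * (k%:R / 2)).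
Proof.
move=> ok N0; rewrite psum_braE ssum_uni_xpow// bcoef_neg_bracket//.
by rewrite ifN// -lt0n.
Qed.

Lemma psum_bra0 k m : odd k -> (forall i N, (0 < N)%N -> m <> xpow i N) ->
  psum_bra k m = 0.
Proof. by move=> _ ne; rewrite psum_braE ssum_uni0. Qed.

(** * The two boson maps *)

Section Hamiltonian.
Variables (M : neutral_fermions) (B : nat -> fock M -> fock M).
(* Both b^(beta)_n and b^[beta]_n act on each vector as a finite combination of b_1, b_3, ...
   with coefficients [kappa n]. *)
Variable kappa : nat -> nat -> Qbeta.
Hypothesis mode_comb : forall n v, (0 < n)%N ->
  exists K0 : nat, forall K : nat, (K0 <= K)%N -> B n v = b_comb (kappa n) K v.

Lemma b_comb_linear c K : linear (b_comb (M := M) c K).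
Proof.
apply: linear_sum => x; apply: linear_scale; apply: b_fock_linear; lia.
Qed.

Lemma mode_linear n : (0 < n)%N -> linear (B n).
Proof.
move=> n0 a u v; have [K1 h1] := mode_comb (a *: u + v) n0.
have [K2 h2] := mode_comb u n0; have [K3 h3] := mode_comb v n0.
rewrite (h1 (K1 + K2 + K3)%N) ?(h2 (K1 + K2 + K3)%N) ?(h3 (K1 + K2 + K3)%N); try lia.
exact: b_comb_linear.
Qed.

Lemma mode_vac n : (0 < n)%N -> B n (vac M) = 0.
Proof.
move=> n0; have [K h] := mode_comb (vac M) n0; rewrite (h K)// /b_comb big1// => x _.
by rewrite b_fock_vac ?scaler0//; lia.
Qed.

Lemma mode_parity n e v : (0 < n)%N -> in_span (parity_word e) (word M) v ->
  in_span (parity_word e) (word M) (B n v).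
Proof.
move=> n0 pv; have [K h] := mode_comb v n0; rewrite (h K)//.
by apply: in_span_sum => x _; apply/in_spanZ/parity_b => //; lia.
Qed.

Lemma mode_bracket n (k : nat) v : (0 < n)%N -> odd k ->
  B n (b_fock (- k%:Z) v) = b_fock (- k%:Z) (B n v) + (kappa n k * (k%:R / 2)) *: v.
Proof.
move=> n0 ok; have k0 : - k%:Z != 0 by lia.
have [K1 h1] := mode_comb (b_fock (- k%:Z) v) n0; have [K2 h2] := mode_comb v n0.
(* Adding [k] ensures that b_k, the only mode with a nonzero commutator with b_(-k), occurs in the
   truncated combination, at the index [k./2]. *)
set K := (K1 + K2 + k)%N; rewrite (h1 K) ?(h2 K); try by rewrite /K; lia.
rewrite /b_comb (lin_sum (b_fock_linear k0)).
have E (x : 'I_K) : kappa n x.*2.+1 *: b_fock x.*2.+1%:Z (b_fock (- k%:Z) v) =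
    b_fock (- k%:Z) (kappa n x.*2.+1 *: b_fock x.*2.+1%:Z v) +
    (kappa n k * (k%:R / 2) * (x.*2.+1 == k)%:R) *: v.
  rewrite b_fock_bracket//=; last by rewrite odd_double.
  rewrite scalerDr (linZ (b_fock_linear k0) (kappa _ _)) (scalerA _ (_ * _)).
  congr (_ + _ *: _).
  by case: eqP => [->|_]; rewrite ?mulr0 ?mulr1.
rewrite (eq_bigr _ (fun x _ => E x)) big_split -scaler_suml -mulr_sumr; congr (_ + _ *: _).
have kK : (k./2 < K)%N by rewrite /K; lia.
rewrite (bigD1 (Ordinal kK))//= big1 ?addr0.
  by rewrite (_ : _ == _) ?mulr1//; lia.
move=> x /eqP xk; case: (x.*2.+1 =P k) => // e; case: xk; apply: val_inj => /=; lia.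
Qed.

Let H := hamiltonian B.

(** Among the power sums only p_N contains the monomial x_i^N, so each coefficient of H involves at
    most one mode. *)
Lemma hamiltonian_xpow i N v : (0 < N)%N -> H (xpow i N) v = (2 / N%:R) *: B N v.
Proof.
move=> N0; rewrite /H /hamiltonian (@fsum_seq _ _ _ [:: N])//; last first.
  move=> n /asboolP n0; rewrite inE => nN; rewrite psum_xpow// eq_sym (negbTE nN).
  by rewrite mulr0 mul0r scale0r.
rewrite big_cons big_nil ifT ?addr0; last by apply/asboolP.
by rewrite psum_xpow// eqxx mulr1.
Qed.

Lemma hamiltonian0 m v : (forall i N, (0 < N)%N -> m <> xpow i N) -> H m v = 0.
Proof.
move=> ne; rewrite /H /hamiltonian fsbig1// => n n0.
by rewrite psum0// mulr0 mul0r scale0r.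
Qed.

Lemma monomial_cases m : (exists i N, (0 < N)%N /\ m = xpow i N) \/
  (forall i N, (0 < N)%N -> m <> xpow i N).
Proof.
have [h|h] := pselect (exists i N, (0 < N)%N /\ m = xpow i N); first by left.
by right => i N N0 mE; apply: h; exists i, N.
Qed.

Lemma hamiltonian_linear m : linear (H m).
Proof.
move=> a u v; case: (monomial_cases m) => [[i [N [N0 ->]]]|ne].
  by rewrite !hamiltonian_xpow// mode_linear// scalerDr !scalerA mulrC.
by rewrite !hamiltonian0// scaler0 addr0.
Qed.

Lemma hamiltonian_mon1 v : H mon1 v = 0.
Proof.
apply: hamiltonian0 => i N N0 /(congr1 (fun a : monomial => a i)).
by rewrite xpowE eqxx fsfunE; lia.
Qed.

Lemma hamiltonian_vac m : H m (vac M) = 0.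
Proof.
case: (monomial_cases m) => [[i [N [N0 ->]]]|ne]; last exact: hamiltonian0.
by rewrite hamiltonian_xpow// mode_vac// scaler0.
Qed.

Lemma boson_odd v : in_span (parity_word true) (word M) v -> boson H v = 0.
Proof.
apply: (boson_parity hamiltonian_linear hamiltonian_mon1) => m u pu.
case: (monomial_cases m) => [[i [N [N0 ->]]]|ne].
  by rewrite hamiltonian_xpow//; apply/in_spanZ/mode_parity.
by rewrite hamiltonian0//; exact: in_span0.
Qed.

Variable ps : nat -> pseries.
Hypothesis ps_xpow : forall k i N, odd k -> (0 < N)%N ->
  ps k (xpow i N) = 2 / N%:R * (kappa N k * (k%:R / 2)).
Hypothesis ps0 : forall k m, odd k -> (forall i N, (0 < N)%N -> m <> xpow i N) ->
  ps k m = 0.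

Lemma boson_bword mu : all odd mu -> boson H (bword M mu) = sprod (map ps mu).
Proof.
elim: mu => [_|k mu IH /= /andP[ok omu]].
  exact: (boson_vac hamiltonian_linear hamiltonian_mon1 hamiltonian_vac).
have k0 : - k%:Z != 0 by lia.
rewrite -IH//; apply: (boson_creation hamiltonian_linear hamiltonian_mon1).
- exact: b_fock_linear.
- by move=> v; exact: covac_b.
move=> m v; case: (monomial_cases m) => [[i [N [N0 ->]]]|ne].
  rewrite !hamiltonian_xpow// mode_bracket// scalerDr ps_xpow// (scalerA _ (_ * _)); congr (_ + _).
  by rewrite (linZ (b_fock_linear k0) (2 / _)).
by rewrite !hamiltonian0// ps0// scale0r addr0 (lin0 (b_fock_linear k0)).
Qed.

End Hamiltonian.

Section BosonMaps.
Variable M : neutral_fermions.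

Lemma boson_H_beta_bword mu : all odd mu ->
  boson (H_beta (M:=M)) (bword M mu) = p_beta mu.
Proof.
apply: boson_bword; [move=> n v n0; exact: b_beta_comb|exact: psum_beta_xpow|exact: psum_beta0].
Qed.

Lemma boson_H_bra_bword mu : all odd mu ->
  boson (H_bra (M:=M)) (bword M mu) = p_bra mu.
Proof.
apply: boson_bword; [move=> n v n0; exact: b_bra_comb|exact: psum_bra_xpow|exact: psum_bra0].
Qed.

Lemma boson_H_beta_linear : linear (boson (H_beta (M:=M)) : fock M -> pseries).
Proof.
move=> a u v; apply/funext => m; apply: boson_linear.
- by apply: (@hamiltonian_linear _ _ _ (fun n v n0 => b_beta_comb v n0)).
- by move=> x; apply: hamiltonian_mon1.
Qed.

Lemma boson_H_bra_linear : linear (boson (H_bra (M:=M)) : fock M -> pseries).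
Proof.
move=> a u v; apply/funext => m; apply: boson_linear.
- by apply: (@hamiltonian_linear _ _ _ (fun n v n0 => b_bra_comb v n0)).
- by move=> x; apply: hamiltonian_mon1.
Qed.

End BosonMaps.

(** * Comparison of the deformed form with the vacuum pairing *)

Section BetaForm.
Variables (M : neutral_fermions) (form : pseries -> pseries -> Qbeta).
Hypothesis hform : is_beta_form form.

(** Linearity is available only inside [U], so 0 is reached there as -1 + 1, where 1 is the product
    over the empty partition. *)
Lemma form0l g : in_gGamma g -> form 0 g = 0.
Proof.
move=> gG; have [fl _ _] := hform.
have U1 : in_U (p_beta [::]) by apply: in_span_gen.
have := fl (-1) _ _ g U1 U1 gG.
by rewrite scaleN1r addNr mulN1r addNr.
Qed.

Lemma form0r f : in_U f -> form f 0 = 0.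
Proof.
move=> fU; have [_ fr _] := hform.
have G1 : in_gGamma (p_bra [::]) by apply: in_span_gen.
have := fr (-1) f _ _ fU G1 G1.
by rewrite scaleN1r addNr mulN1r addNr.
Qed.

Lemma form_boson_even (v w : fock M) :
  in_span (parity_word false) (word M) v -> in_span (parity_word false) (word M) w ->
  form (boson (H_beta (M:=M)) v) (boson (H_bra (M:=M)) w) = bracket_form w v.
Proof.
have [fl fr fE] := hform.
move=> /parity_span pv /parity_span pw.
have gG u : in_span odd_part (bword M) u -> in_gGamma (boson (H_bra (M:=M)) u).
  apply: (in_span_map (@boson_H_bra_linear M)) => mu omu.
  by rewrite boson_H_bra_bword; [exact: in_span_gen|case/andP: omu].
have fU u : in_span odd_part (bword M) u -> in_U (boson (H_beta (M:=M)) u).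
  apply: (in_span_map (@boson_H_beta_linear M)) => mu omu.
  by rewrite boson_H_beta_bword; [exact: in_span_gen|case/andP: omu].
(* The induction carries membership in [U] along, because the form is known to be linear only
   there. *)
suff H : in_U (boson (H_beta (M:=M)) v) /\
    form (boson (H_beta (M:=M)) v) (boson (H_bra (M:=M)) w) = bracket_form w v.
  by case: H.
move: v pv; apply: (in_span_lift (T := fun v => in_U (boson (H_beta (M:=M)) v) /\
    form (boson (H_beta (M:=M)) v) (boson (H_bra (M:=M)) w) = bracket_form w v)).
- rewrite (lin0 (@boson_H_beta_linear M)) (lin0 (bracket_form_linearr w)).
  by split; [exact: in_span0|exact/form0l/gG].
- move=> a u v [uU uE] [vU vE]; rewrite (@boson_H_beta_linear M) (bracket_form_linearr w).
  by split; [exact: in_span_lin|rewrite fl ?uE ?vE//; exact: gG].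
move=> la ola; have [sla oola] := andP ola.
have lU := fU _ (in_span_gen (bword M) ola); split => //.
suff H : in_gGamma (boson (H_bra (M:=M)) w) /\
    form (boson (H_beta (M:=M)) (bword M la)) (boson (H_bra (M:=M)) w) = bracket_form w (bword M la).
  by case: H.
move: w pw; apply: (in_span_lift (T := fun w => in_gGamma (boson (H_bra (M:=M)) w) /\
    form (boson (H_beta (M:=M)) (bword M la)) (boson (H_bra (M:=M)) w) = bracket_form w (bword M la))).
- rewrite (lin0 (@boson_H_bra_linear M)) (lin0 (bracket_form_linearl _)).
  by split; [exact: in_span0|exact: form0r].
- move=> a u v [uU uE] [vU vE]; rewrite (@boson_H_bra_linear M) (bracket_form_linearl (bword M la)).
  by split; [exact: in_span_lin|rewrite fr ?uE ?vE//; exact: gG].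
move=> mu omu; have [smu oomu] := andP omu.
split; first by apply: gG; exact: in_span_gen.
rewrite boson_H_beta_bword// boson_H_bra_bword// fE// bracket_form_bword//.
case: (eqVneq la mu) => [->|ne]; first by rewrite perm_refl.
case: (boolP (perm_eq mu la)) => [p|_]; last by rewrite !mulr0.
by move: ne; rewrite (odd_part_perm omu ola p) eqxx.
Qed.

End BetaForm.

Theorem proposition8p3 (M : neutral_fermions)
    (form : pseries -> pseries -> Qbeta) (hform : is_beta_form form)
    (v w : fock M) (hpar : fock_even v \/ fock_even w)
    (f g : pseries)
    (hf : f = boson (H_beta (M:=M)) v) (hg : g = boson (H_bra (M:=M)) w) :
  form f g = pairing (star_fock w) v.
Proof.
rewrite hf hg -/(bracket_form w v).
have [v0 [v1 [vE pv0 pv1]]] := parity_split v.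
have [w0 [w1 [wE pw0 pw1]]] := parity_split w.
have beta_v : boson (H_beta (M:=M)) v = boson (H_beta (M:=M)) v0.
  rewrite vE (linD (@boson_H_beta_linear M)).
  by rewrite (boson_odd (fun n v n0 => b_beta_comb v n0) pv1) addr0.
have bra_w : boson (H_bra (M:=M)) w = boson (H_bra (M:=M)) w0.
  rewrite wE (linD (@boson_H_bra_linear M)).
  by rewrite (boson_odd (fun n v n0 => b_bra_comb v n0) pw1) addr0.
rewrite beta_v bra_w form_boson_even//.
(* The product <w1|v1> of the odd components is the only term the form does not see. It vanishes as
   soon as one of the two vectors is even; the mixed terms vanish by parity. *)
case: hpar => [/fock_even_parity pv|/fock_even_parity pw].
  rewrite [in RHS]wE (linD (bracket_form_linearl v)).
  rewrite (bracket_form_parity pw1 pv) addr0 vE (linD (bracket_form_linearr w0)).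
  by rewrite (bracket_form_parity pw0 pv1) addr0.
rewrite [in RHS]vE (linD (bracket_form_linearr w)).
rewrite (bracket_form_parity pw pv1) addr0 wE (linD (bracket_form_linearl v0)).
by rewrite (bracket_form_parity pw1 pv0) addr0.
Qed.
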